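(* Let $R$ be an integer-valued random variable with values in $[0,n[$ (its distribution may depend on $n$) such that $\mathbb{E}[R]=\Theta(1)$ and $\mathrm{Var}[R]=O(1)$. Then the expected rumor spreading time of the $R$-push protocol on the complete graph with $n$ vertices is equal to $$\log_{1+\mathbb{E}[R]} n+\frac{1}{\mathbb{E}[R]}\ln n\pm O(1).$$
   Context: $R$-push protocol on the complete graph with $n$ nodes: initially exactly one node is informed. In each round, every node that was informed at the beginning of the round independently samples a fresh value $r$ from the distribution of $R$ and then calls $r$ different nodes, forming a uniformly random $r$-element subset of the set of all $n$ nodes (the node itself may be included), chosen independently of the other nodes' choices; it sends the rumor to all of them, and called nodes are informed from the end of that round on. The rumor spreading time is the number of rounds until all nodes are informed. $\Theta(1)$, $O(1)$ are with respect to $n\to\infty$: $\mathbb{E}[R]$ lies between two positive constants and $\mathrm{Var}[R]$ is bounded by a constant, uniformly in $n$; $\pm O(1)$ denotes a deviation bounded in absolute value by a constant independent of $n$, for all sufficiently large $n$. *)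

(* Defs.v *)
From HB Require Import structures.
From mathcomp Require Import all_boot all_order all_algebra.
From mathcomp Require Import finmap.
From mathcomp Require Import all_classical all_reals all_analysis.

Set Implicit Arguments.
Unset Strict Implicit.
Unset Printing Implicit Defensive.

Import Order.TTheory GRing.Theory Num.Theory.

Local Open Scope classical_set_scope.
Local Open Scope ring_scope.

Definition log_base (K : realType) (b x : K) : K := ln x / ln b.

(* [V] carries no sigma-algebra: this is meant for countable [V] and maps whose
   fibres are all measurable, so that every [B i : set V] gives an event. *)
Definition mutually_independent (K : realType) (d : measure_display)
    (T : measurableType d) (P : probability T K) (I : choiceType) (V : Type)
    (X : I -> T -> V) : Prop :=
  forall (J : {fset I}) (B : I -> set V),
    P (\bigcap_(i in [set` J]) (X i @^-1` B i)) =
    (\prod_(i <- J) P (X i @^-1` B i))%E.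

(* [draw t v] is the number of calls sampled by node [v] in round [t.+1] and
   [call t v] the set of nodes it calls. These are drawn for all nodes; the
   draws of nodes that are not yet informed are ignored by [informed]. *)
Record push_calls (K : realType) (dR : measure_display)
    (TR : measurableType dR) (PR : probability TR K) (R : TR -> K) (n : nat)
    (d : measure_display) (T : measurableType d) (P : probability T K)
    (draw : nat -> 'I_n -> T -> nat)
    (call : nat -> 'I_n -> T -> {set 'I_n}) : Prop := PushCalls {
  push_calls_measurable : forall (t : nat) (v : 'I_n) (r : nat) (A : {set 'I_n}),
    measurable [set w | draw t v w = r /\ call t v w = A];
  push_calls_law : forall (t : nat) (v : 'I_n) (r : nat) (A : {set 'I_n}),
    P [set w | draw t v w = r /\ call t v w = A] =
    (if #|A| == r
     then PR [set x | R x = r%:R] * (('C(n, r))%:R^-1)%:E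
     else 0)%E;
  push_calls_independent :
    mutually_independent P
      (fun (tv : nat * 'I_n) w => (draw tv.1 tv.2 w, call tv.1 tv.2 w)) }.

Fixpoint informed (n : nat) (T : Type) (start : 'I_n)
    (call : nat -> 'I_n -> T -> {set 'I_n}) (t : nat) (w : T) : {set 'I_n} :=
  if t is s.+1 then
    informed start call s w
      :|: \bigcup_(v in informed start call s w) call s v w
  else [set start]%SET.

(* The infimum is [+oo] when some node is never informed. *)
Definition spreading_time (K : realType) (n : nat) (T : Type) (start : 'I_n)
    (call : nat -> 'I_n -> T -> {set 'I_n}) (w : T) : \bar K :=
  ereal_inf [set (t%:R)%:E | t in
    [set t : nat | informed start call t w = [set: 'I_n]%SET]].

(* Main.v *)
Require Import Defs.
From HB Require Import structures.
From mathcomp Require Import all_boot all_order all_algebra.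
From mathcomp Require Import finmap.
From mathcomp Require Import ring lra.
From mathcomp Require Import all_classical all_reals all_analysis.
From mathcomp Require Import measurable_realfun.

Set Implicit Arguments.
Unset Strict Implicit.
Unset Printing Implicit Defensive.

Import Order.TTheory GRing.Theory Num.Theory.

Local Open Scope classical_set_scope.
Local Open Scope ring_scope.

(* Write k for the number of informed nodes, u = n - k, m = E[R], x = k/n, and
   s = (1 - m/n)^k for the probability that a given uninformed node is not
   called in the round. The next value U of u has mean u s and, the calls of
   two nodes by one caller being almost uncorrelated, variance O(u k / n).
   The function
     f(u) = log_{1+m} (n / k) + ln (1 + u) / m
   decreases in expectation by 1 per round, up to errors O(x (1 - x)),
   O((1 - x) / k) and O(x / sqrt (1 + u)): for small x the first term does all
   the work, for x near 1 the second one, and in between the two speeds add up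
   to 1. Each error is absorbed by the drift of a bounded correction, namely a
   multiple of u/n, of 1/k, of 1/(1+u) or of 1/sqrt(1+u), so that f plus or
   minus corrections is a super- or a sub-solution of the hitting-time equation
   of the chain of informed sets. Hence the expected time is f(n - 1) + O(1),
   and f(n - 1) = log_{1+m} n + (ln n) / m. *)

(** * Tangent inequalities and weighted means *)

Section LogBounds.
Variable K : realType.
Implicit Types z w : K.

Lemma ln_le_tangent z w : 0 < z -> 0 < w -> ln z <= ln w + (z - w) / w.
Proof.
move=> z0 w0; have zw0 : 0 < z / w by rewrite divr_gt0.
have : ln (1 + (z / w - 1)) <= z / w - 1 by apply: le_ln1Dx; lra.
rewrite addrCA subrr addr0 => {zw0}.
rewrite ln_div ?posrE // mulrBl divff ?gt_eqF //; lra.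
Qed.

(** This is [ln_le_tangent] with [z] and [w] exchanged: [(w - z) / z] is split into the linear term
    at [w] and a quadratic error, so that, once [z] is bounded below, its mean and variance
    suffice. *)
Lemma ln_ge_tangent z w : 0 < z -> 0 < w ->
  ln w + (z - w) / w - (z - w) ^+ 2 / (z * w) <= ln z.
Proof.
move=> z0 w0; have := ln_le_tangent w0 z0.
have -> : ln w + (z - w) / w - (z - w) ^+ 2 / (z * w) = ln w - (w - z) / z.
  by field; rewrite !gt_eqF.
lra.
Qed.

(* With [w ^+ 2] in place of [w * sqrt w] no constant works for [z] near 1 and
   [w] large. *)
Lemma ln_ge_tangent_sqrt z w : 1 <= z -> 1 <= w ->
  ln w + (z - w) / w - 4 * ((z - w) ^+ 2 / (w * Num.sqrt w)) <= ln z.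
Proof.
move=> z1 w1.
have z0 : 0 < z by lra.
have w0 : 0 < w by lra.
set r := Num.sqrt w.
have r0 : 0 < r by rewrite sqrtr_gt0.
have rr : r ^+ 2 = w by rewrite sqr_sqrtr ?ltW.
have r1 : 1 <= r by nra.
have wr0 : 0 < w * r by rewrite mulr_gt0.
(* For [z >= w / 4], the bound [r <= w <= 4 z] turns the error of [ln_ge_tangent] into the required
   one. For smaller [z] the deviation is so large that the error term is at least [2 r >= ln w],
   while [ln z >= 0]. *)
have [zw|zw] := leP (w / 4) z.
  apply: le_trans (ln_ge_tangent z0 w0); rewrite lerD2l lerN2.
  rewrite mulrA ler_pdivrMr ?mulr_gt0 // mulrAC ler_pdivlMr //.
  have : 0 <= (z - w) ^+ 2 by rewrite sqr_ge0.
  set t := (z - w) ^+ 2 => t0.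
  have : w * r <= 4 * (z * w) by nra.
  nra.
have lnz : 0 <= ln z by rewrite ln_ge0.
have lnw : ln w <= 2 * r.
  have -> : ln w = 2 * ln r by rewrite -rr lnXn // mulr_natl.
  by have := ln_sublinear r0; lra.
have : (z - w) / w <= 0 by rewrite pmulr_lle0 ?invr_gt0 //; lra.
have : 1/2 * r <= (z - w) ^+ 2 / (w * r).
  rewrite ler_pdivlMr //.
  have -> : 1/2 * r * (w * r) = 1/2 * w ^+ 2 by rewrite -rr; ring.
  nra.
lra.
Qed.

Lemma inv_ge_tangent z w : 0 < z -> 0 < w ->
  w^-1 * (1 + (w - z) / w) <= z^-1.
Proof.
move=> z0 w0; rewrite -subr_ge0.
have -> : z^-1 - w^-1 * (1 + (w - z) / w) = (z - w) ^+ 2 / (z * w ^+ 2).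
  by field; rewrite !gt_eqF.
by rewrite divr_ge0 ?sqr_ge0 // mulr_ge0 ?sqr_ge0 // ltW.
Qed.

Lemma inv_sqrt_ge_tangent z w : 0 < z -> 0 < w ->
  (Num.sqrt w)^-1 * (1 + (w - z) / (2 * w)) <= (Num.sqrt z)^-1.
Proof.
move=> z0 w0; rewrite -subr_ge0.
have s0 : 0 < Num.sqrt z by rewrite sqrtr_gt0.
have r0 : 0 < Num.sqrt w by rewrite sqrtr_gt0.
rewrite -[X in (X - z) / (2 * w)](sqr_sqrtr (ltW w0)).
rewrite -[X in (_ - X) / (2 * w)](sqr_sqrtr (ltW z0)).
rewrite -[X in (2 * X)](sqr_sqrtr (ltW w0)).
move: (Num.sqrt z) (Num.sqrt w) s0 r0 => s r s0 r0.
have -> : s^-1 - r^-1 * (1 + (r ^+ 2 - s ^+ 2) / (2 * r ^+ 2)) =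
    (r - s) ^+ 2 * (2 * r + s) / (2 * s * r ^+ 3).
  by field; rewrite !gt_eqF.
apply: divr_ge0; first by apply: mulr_ge0; [exact: sqr_ge0 | lra].
by rewrite !mulr_ge0 ?exprn_ge0 ?ltW.
Qed.

(** Concavity of [ln] between 1 and [z]: the tangent at the intermediate point [w] bounds both ends,
    and with weights [t] and [1 - t] the linear terms cancel. *)
Lemma ln_chord z t : 0 < z -> 0 <= t <= 1 -> t * ln z <= ln (1 + t * (z - 1)).
Proof.
move=> z0 /andP[t0 t1]; set w := 1 + _.
have w0 : 0 < w by rewrite /w; nra.
have := ln_le_tangent z0 w0.
have := ln_le_tangent ltr01 w0; rewrite ln1.
set a := (1 - w) / w; set b := (z - w) / w.
have : t * b + (1 - t) * a = 0 by rewrite /a /b /w; field; rewrite -/w gt_eqF.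
nra.
Qed.

End LogBounds.

Section WeightedMean.
Variables (K : realType) (I : finType) (W : I -> K).
Hypotheses (W_ge0 : forall i, 0 <= W i) (W_sum : \sum_i W i = 1).

Definition wmean (X : I -> K) : K := \sum_i W i * X i.

Lemma wmean_cst c : wmean (fun=> c) = c.
Proof. by rewrite /wmean -mulr_suml W_sum mul1r. Qed.

Lemma wmeanD X Y : wmean (fun i => X i + Y i) = wmean X + wmean Y.
Proof. by rewrite /wmean -big_split; apply: eq_bigr => i _; rewrite mulrDr. Qed.

Lemma wmeanZ c X : wmean (fun i => c * X i) = c * wmean X.
Proof. by rewrite /wmean mulr_sumr; apply: eq_bigr => i _; rewrite mulrCA. Qed.

Lemma le_wmean X Y : (forall i, X i <= Y i) -> wmean X <= wmean Y.
Proof. by move=> XY; apply: ler_sum => i _; rewrite ler_wpM2l. Qed.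

Lemma eq_wmean X Y : X =1 Y -> wmean X = wmean Y.
Proof. by move=> XY; apply: eq_bigr => i _; rewrite XY. Qed.

(** Every one-round estimate below goes through this lemma or its mirror image: a pointwise
    quadratic bound becomes a bound in terms of mean and second moment. With [c = 0] and a tangent
    it is Jensen's inequality. *)
Lemma wmean_le_quadratic X Y a b c y :
  (forall i, X i <= a + b * Y i + c * (Y i - y) ^+ 2) ->
  wmean X <= a + b * wmean Y + c * wmean (fun i => (Y i - y) ^+ 2).
Proof. by move=> /le_wmean; rewrite !wmeanD wmean_cst !wmeanZ. Qed.

Lemma wmean_ge_quadratic X Y a b c y :
  (forall i, a + b * Y i + c * (Y i - y) ^+ 2 <= X i) ->
  a + b * wmean Y + c * wmean (fun i => (Y i - y) ^+ 2) <= wmean X.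
Proof. by move=> /le_wmean; rewrite !wmeanD wmean_cst !wmeanZ. Qed.

Lemma wmean_sqr_shift Y y z : wmean Y = y ->
  wmean (fun i => (Y i - z) ^+ 2) =
  wmean (fun i => (Y i - y) ^+ 2) + (y - z) ^+ 2.
Proof.
move=> Yy.
have -> : wmean (fun i => (Y i - z) ^+ 2) = wmean (fun i => (Y i - y) ^+ 2 +
    (2 * (y - z) * Y i + ((y - z) ^+ 2 - 2 * (y - z) * y))).
  by apply: eq_wmean => i; ring.
rewrite !wmeanD (wmeanZ _ Y) !wmean_cst Yy; ring.
Qed.

End WeightedMean.

(** * Drift of the potentials in one round *)

(** Here [u] counts the uninformed nodes. The shift to [1 + u] keeps the logarithm's argument
    positive when everyone is informed, and the constant 1 in the last correction makes that
    correction nonnegative. *)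
Definition super_pot (K : realType) (D1 D2 D3 m n u : K) : K :=
  (ln n - ln (n - u)) / ln (1 + m) + ln (1 + u) / m
  + D1 * (u / n) + D2 / (n - u) + D3 * (1 - (1 + u)^-1).

(** It vanishes at [u = 0], as a lower bound on the hitting time requires. The square root matches
    the variance error of [ln (1 + U)], which is of order [x / sqrt (1 + u)]. *)
Definition sub_pot (K : realType) (D1 D2 m n u : K) : K :=
  (ln n - ln (n - u)) / ln (1 + m) + ln (1 + u) / m
  - D1 * (u / n) - D2 * (1 - (Num.sqrt (1 + u))^-1).

Section OneStep.
Variables (K : realType) (I : finType) (W : I -> K).
Hypotheses (W_ge0 : forall i, 0 <= W i) (W_sum : \sum_i W i = 1).
Variables (a b V s0 : K).
Hypotheses (a0 : 0 < a) (V0 : 0 < V) (s0_gt0 : 0 < s0) (s0_le1 : s0 <= 1).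
Variables (m n k u s : K) (U : I -> K).
Hypotheses (am : a <= m) (mb : m <= b).
Hypotheses (k1 : 1 <= k) (u1 : 1 <= u) (kun : k + u = n).
Hypotheses (U_ge0 : forall i, 0 <= U i) (U_le : forall i, U i <= u).
Hypotheses (U_mean : wmean W U = u * s)
  (U_var : wmean W (fun i => (U i - u * s) ^+ 2) <= V * (u * k / n)).
Hypotheses (s_gt : s0 <= s) (s_lt : 1 - s <= m * (k / n))
  (s_le : m * (k / n) / (1 + m * (k / n)) <= 1 - s)
  (ln_s_le : ln s <= - (m * (k / n)))
  (ln_s_ge : - (m * (k / n)) - 2 * m ^+ 2 * (k / n) * (u / n) <= ln s).

Local Notation x := (k / n).
Local Notation y := (u / n).

Let m0 : 0 < m. Proof. exact: lt_le_trans am. Qed.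
Let b0 : 0 < b. Proof. exact: lt_le_trans mb. Qed.
Let k0 : 0 < k. Proof. exact: lt_le_trans k1. Qed.
Let u0 : 0 < u. Proof. exact: lt_le_trans u1. Qed.
Let n0 : 0 < n. Proof. by rewrite -kun addr_gt0. Qed.
Let x0 : 0 < x. Proof. by rewrite divr_gt0. Qed.
Let y0 : 0 < y. Proof. by rewrite divr_gt0. Qed.
Let xy1 : x + y = 1. Proof. by rewrite -mulrDl kun divff // gt_eqF. Qed.
Let yk0 : 0 < y * k. Proof. exact: mulr_gt0. Qed.
Let mx0 : 0 < m * x. Proof. exact: mulr_gt0. Qed.
Let s_pos : 0 < s. Proof. exact: lt_le_trans s_gt. Qed.

(* Copies section hypotheses to the proof context, where [lra] looks for them. *)
Ltac facts :=
  move: a0 am mb k1 u1 kun V0 s0_gt0 s0_le1 s_gt => ? ? ? ? ? ? ? ? ? ?;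
  move: m0 b0 k0 u0 n0 x0 y0 xy1 s_pos yk0 mx0 => ? ? ? ? ? ? ? ? ? ? ?.

Let s_le_V : m * x / (1 + b) <= 1 - s.
Proof.
facts; apply: le_trans s_le; apply: ler_wpM2l; first by rewrite mulr_ge0 ?ltW.
by rewrite lef_pV2 ?posrE; nra.
Qed.

Let s_lt1 : s < 1.
Proof.
facts; rewrite -subr_gt0; apply: lt_le_trans s_le_V.
by apply: divr_gt0; [exact: mulr_gt0 | lra].
Qed.

Let Vyk : u * k / n = y * k. Proof. by rewrite mulrAC. Qed.
Let ux : u * x = y * k. Proof. by rewrite mulrA Vyk. Qed.

Let us_le : u * (1 - s) <= m * y * k.
Proof.
facts.
have -> : m * y * k = u * (m * x) by rewrite (mulrCA u m) ux -mulrA.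
by rewrite ler_pM2l.
Qed.

Let us_ge : m / (1 + b) * (y * k) <= u * (1 - s).
Proof.
facts.
have -> : m / (1 + b) * (y * k) = u * (m * x / (1 + b)) by rewrite -ux; ring.
by rewrite ler_pM2l.
Qed.

(** At the mean [w] of the next informed count, [s_le] gives [w / k >= 1 + y * (m / (1 + m * x))];
    the chord with weight [y] and [ln (1 + m * x) <= m * x] then give all but the last term. That
    term is the variance cost: both [n - U i] and [w] are at least [k], so the quadratic error is at
    most [V * (y * k) / k ^ 2]. *)
Lemma mean_ln_informed_ge :
  ln k + y * ln (1 + m) - m * (x * y) - V * (y / k) <=
  wmean W (fun i => ln (n - U i)).
Proof.
facts.
set w := n - u * s.
have wE : w = k + u * (1 - s) by rewrite /w -kun; ring.
have us1 : 0 <= u * (1 - s) by have := s_lt1; nra.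
have kw : k <= w by lra.
have w0 : 0 < w by lra.
apply: (@le_trans _ _ (ln w - V * (y / k))).
  rewrite lerB //.
  have -> : w = k * (1 + u * (1 - s) / k) by rewrite wE; field; rewrite gt_eqF.
  have z0 : 0 < 1 + m / (1 + m * x) by rewrite addr_gt0 // divr_gt0 //; nra.
  have mx1 : 0 < 1 + m * x by nra.
  rewrite lnM ?posrE //; last first.
    by apply: addr_gt0 => //; apply: divr_gt0 => //; rewrite mulr_gt0 ?subr_gt0.
  rewrite -addrA lerD2l.
  apply: (@le_trans _ _ (y * ln (1 + m / (1 + m * x)))).
    have -> : y * ln (1 + m) - m * (x * y) = y * (ln (1 + m) - m * x) by ring.
    rewrite ler_pM2l //.
    apply: (@le_trans _ _ (ln (1 + m) - ln (1 + m * x))).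
      by rewrite lerB // le_ln1Dx //; nra.
    rewrite -ln_div ?posrE //; last lra.
    rewrite ler_ln ?posrE ?divr_gt0 //; last lra.
    rewrite ler_pdivrMr // mulrDl divfK ?gt_eqF //; nra.
  apply: le_trans (ln_chord z0 _) _; first by rewrite ltW //=; lra.
  have h : 0 <= y * (m / (1 + m * x)) by rewrite mulr_ge0 ?divr_ge0 ?ltW.
  have e : y * (1 + m / (1 + m * x) - 1) <= u * (1 - s) / k.
    rewrite ler_pdivlMr //.
    have -> : y * (1 + m / (1 + m * x) - 1) * k = u * (m * x / (1 + m * x)).
      by field; rewrite !gt_eqF //; nra.
    by rewrite ler_pM2l.
  by rewrite ler_ln ?posrE; nra.
apply: (@le_trans _ _ (ln w + (n - w) / w + (- w^-1) * wmean W U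
    + (- (k * k)^-1) * wmean W (fun i => (U i - u * s) ^+ 2))).
  rewrite U_mean.
  have -> : n - w = u * s by rewrite /w; ring.
  have -> : - w^-1 * (u * s) = - (u * s / w) by ring.
  rewrite addrK mulNr lerD2l lerN2.
  apply: (@le_trans _ _ ((k * k)^-1 * (V * (y * k)))).
    by apply: ler_wpM2l; [rewrite invr_ge0 mulr_ge0 ?ltW | rewrite -Vyk].
  by rewrite le_eqVlt; apply/orP; left; apply/eqP; field; rewrite !gt_eqF.
apply: wmean_ge_quadratic => // i.
have Ui : k <= n - U i by have := U_le i; lra.
have Ui0 : 0 < n - U i by lra.
apply: le_trans (ln_ge_tangent Ui0 w0).
have -> : n - U i - w = - (U i - u * s) by rewrite /w; ring.
rewrite sqrrN -!addrA lerD2l addrA lerD //.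
  by rewrite le_eqVlt; apply/orP; left; apply/eqP; rewrite /w; field; rewrite -/w gt_eqF.
rewrite mulNr lerN2 (mulrC _^-1); apply: ler_wpM2l; first exact: sqr_ge0.
by rewrite lef_pV2 ?posrE ?mulr_gt0 // ler_pM // ltW.
Qed.

Local Notation c2 := ((a / (1 + b)) ^+ 2 / (1 + b + V + b ^+ 2)).

(** The decrease of [1 / k] is what pays for the variance cost [V * (y / k)] of
    [mean_ln_informed_ge]. *)
Lemma mean_inv_informed_le :
  wmean W (fun i => (n - U i)^-1) <= k^-1 - c2 * (y / k).
Proof.
facts.
set d := 1 + b + V + b ^+ 2; set p := a / (1 + b).
have d0 : 0 < d by rewrite /d; nra.
have p0 : 0 < p by rewrite divr_gt0 //; lra.
(* The mean number [A] of new nodes is at least [p * (y * k)], and [A + S / k] below is at most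
   [d * (y * k)]. The gain is thus at least [2 * l * p - l ^ 2 * d] times [y / k]; this [l]
   maximizes it, with value [p ^ 2 / d]. *)
pose l := p / d.
have l0 : 0 < l by rewrite divr_gt0.
have ld : l * d = p by rewrite divfK // gt_eqF.
have -> : p ^+ 2 / d = l * p by rewrite /l; ring.
pose A := u * (1 - s).
have A_ge : p * (y * k) <= A.
  apply: le_trans us_ge; rewrite ler_pM2r //.
  by rewrite ler_pM2r // invr_gt0; lra.
have A_le : A <= b * (y * k).
  by apply: le_trans us_le _; rewrite -mulrA ler_pM2r.
have A0 : 0 < A by apply: lt_le_trans A_ge; exact: mulr_gt0.
have A2 : A ^+ 2 <= b ^+ 2 * (y * k) * k.
  apply: (@le_trans _ _ ((b * (y * k)) ^+ 2)).
    by rewrite ler_sqr ?nnegrE; lra.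
  have -> : (b * (y * k)) ^+ 2 = b ^+ 2 * (y * k) * k * y by ring.
  by apply: ler_piMr; [rewrite mulr_ge0 ?ltW // mulr_gt0 // exprn_gt0 | lra].
set S := wmean W (fun i => (U i - u) ^+ 2).
have S_le : S / k <= (V + b ^+ 2) * (y * k).
  rewrite ler_pdivrMr // /S (wmean_sqr_shift W_sum u U_mean).
  have -> : (u * s - u) ^+ 2 = A ^+ 2 by rewrite /A; ring.
  have := U_var; rewrite Vyk.
  have : V * (y * k) <= V * (y * k) * k by rewrite ler_peMr // ltW // mulr_gt0.
  lra.
(* With [D] newly informed nodes, AM-GM gives
   [D / (k + D) >= 2 (l / k) D - (l / k)^2 D (k + D)]. *)
apply: (@le_trans _ _ (k^-1 - (2 * l - l ^+ 2) / k ^+ 2 * u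
    + (2 * l - l ^+ 2) / k ^+ 2 * wmean W U + l ^+ 2 / k ^+ 3 * S)).
  apply: wmean_le_quadratic => // i.
  have Ui := U_le i.
  have Ui0 : 0 < n - U i by lra.
  have D0 : 0 <= u - U i by lra.
  rewrite -subr_ge0.
  set rhs := (X in 0 <= X).
  have -> : rhs = (u - U i) * (l * (n - U i) - k) ^+ 2 / (k ^+ 3 * (n - U i)).
    rewrite /rhs -kun; field; rewrite !gt_eqF //; lra.
  apply: divr_ge0; first by apply: mulr_ge0; last exact: sqr_ge0.
  by apply: mulr_ge0; [exact/exprn_ge0/ltW | exact: ltW].
rewrite U_mean -subr_ge0.
set rhs := (X in 0 <= X).
have -> : rhs = ((2 * l - l ^+ 2) * A - l ^+ 2 * (S / k) - l * p * (y * k)) / k ^+ 2.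
  by rewrite /rhs /A; field; rewrite !gt_eqF.
apply: divr_ge0; last by rewrite sqr_ge0.
have : 0 <= l * (A - p * (y * k)) by rewrite mulr_ge0 // ?subr_ge0 // ltW.
have : 0 <= l ^+ 2 * (d * (y * k) - A - S / k).
  rewrite mulr_ge0 ?sqr_ge0 //.
  have -> : d = 1 + b + (V + b ^+ 2) by rewrite /d; ring.
  lra.
have -> : l ^+ 2 * (d * (y * k) - A - S / k) =
  l * (l * d) * (y * k) - l ^+ 2 * (A + S / k) by ring.
rewrite ld; lra.
Qed.

(** Jensen reduces the mean to [ln (1 + u * s) = ln s + ln (s^-1 + u)]. The first summand is at most
    [- (m * x)]; in the second, replacing [s^-1] by 1 costs at most [(s^-1 - 1) / (1 + u)]. *)
Lemma mean_ln_uninformed_le :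
  wmean W (fun i => ln (1 + U i)) <=
  ln (1 + u) - m * x + b / s0 * (x / (1 + u)).
Proof.
facts; set w := 1 + u * s.
have w0 : 0 < w by rewrite /w; nra.
have u10 : 0 < 1 + u by lra.
apply: (@le_trans _ _ (ln w)).
  have -> : ln w = (ln w + (1 - w) / w) + w^-1 * wmean W U
      + 0 * wmean W (fun i => (U i - 0) ^+ 2).
    by rewrite U_mean mul0r addr0 /w; field; rewrite -/w gt_eqF.
  apply: wmean_le_quadratic => // i.
  have Ui0 := U_ge0 i.
  rewrite mul0r addr0 -addrA; apply: le_trans (ln_le_tangent _ w0) _; first lra.
  by rewrite lerD2l le_eqVlt; apply/orP; left; apply/eqP; field; rewrite gt_eqF.
have z0 : 0 < s^-1 + u by rewrite addr_gt0 ?invr_gt0.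
have -> : w = s * (s^-1 + u) by rewrite /w mulrDr divff ?gt_eqF // mulrC.
rewrite lnM ?posrE //.
have := ln_le_tangent z0 u10; have := ln_s_le.
have : (s^-1 + u - (1 + u)) / (1 + u) <= b / s0 * (x / (1 + u)).
  rewrite [leRHS]mulrA ler_pM2r ?invr_gt0 //.
  have -> : s^-1 + u - (1 + u) = (1 - s) / s by field; rewrite gt_eqF.
  rewrite ler_pdivrMr //; apply: (le_trans s_lt).
  have -> : b / s0 * x * s = b * x * (s / s0) by ring.
  apply: (@le_trans _ _ (b * x)); first by rewrite ler_pM2r.
  by apply: ler_peMr; [exact/ltW/mulr_gt0 | rewrite ler_pdivlMr // mul1r].
lra.
Qed.

(** Convexity: the tangent at [1 + u] turns the mean loss [u * (1 - s)] into a gain. The factor 2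
    comes from [u / (1 + u) >= 1 / 2]. *)
Lemma mean_inv_uninformed_ge :
  (1 + u)^-1 + a / (2 * (1 + b)) * (x / (1 + u)) <=
  wmean W (fun i => (1 + U i)^-1).
Proof.
facts; set w := 1 + u.
have w0 : 0 < w by rewrite /w; lra.
apply: (@le_trans _ _ (w^-1 * (1 + (w - 1) / w) + (- (w^-1 * w^-1)) * wmean W U
      + 0 * wmean W (fun i => (U i - 0) ^+ 2))); last first.
  apply: wmean_ge_quadratic => // i.
  have Ui0 := U_ge0 i.
  rewrite mul0r addr0; apply: le_trans (inv_ge_tangent _ w0); last lra.
  by rewrite le_eqVlt; apply/orP; left; apply/eqP; field; rewrite gt_eqF.
rewrite U_mean mul0r addr0.
have -> : w^-1 * (1 + (w - 1) / w) + - (w^-1 * w^-1) * (u * s) =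
    w^-1 + (u / w) * (1 - s) / w.
  by rewrite /w; field; rewrite -/w gt_eqF.
rewrite lerD2l [leLHS]mulrA ler_pM2r ?invr_gt0 //.
have -> : a / (2 * (1 + b)) * x = 2^-1 * (a * x / (1 + b)).
  by field; rewrite gt_eqF //; lra.
apply: ler_pM; first by rewrite invr_ge0.
- by apply/ltW/divr_gt0; [exact: mulr_gt0 | lra].
- by rewrite ler_pdivlMr // /w; lra.
apply: le_trans s_le_V; rewrite ler_pM2r ?invr_gt0; last lra.
by rewrite ler_pM2r.
Qed.

Lemma mean_ln_informed_le :
  wmean W (fun i => ln (n - U i)) <= ln k + y * ln (1 + m) + 2 * m * (x * y).
Proof.
facts; set w := n - u * s.
have wE : w = k + u * (1 - s) by rewrite /w -kun; ring.
have us1 : 0 <= u * (1 - s) by have := s_lt1; nra.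
have w0 : 0 < w by lra.
apply: (@le_trans _ _ (ln w)).
  have -> : ln w = (ln w + (n - w) / w) + (- w^-1) * wmean W U
      + 0 * wmean W (fun i => (U i - 0) ^+ 2).
    by rewrite U_mean mul0r addr0 /w; field; rewrite -/w gt_eqF.
  apply: wmean_le_quadratic => // i.
  have Ui0 := U_le i.
  rewrite mul0r addr0 -addrA; apply: le_trans (ln_le_tangent _ w0) _; first lra.
  by rewrite lerD2l le_eqVlt; apply/orP; left; apply/eqP; field; rewrite gt_eqF.
have my0 : 0 < m * y by rewrite mulr_gt0.
have wk : w <= k * (1 + m * y).
  by rewrite wE (mulrDr k) mulr1 lerD2l (mulrC k); exact: us_le.
apply: (@le_trans _ _ (ln (k * (1 + m * y)))).
  by rewrite ler_ln ?posrE ?mulr_gt0 //; lra.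
rewrite lnM ?posrE //; last lra.
rewrite -addrA lerD2l.
have l0 : 0 <= ln (1 + m) by apply: ln_ge0; lra.
(* Concavity puts [ln (1 + m * y)] above [y * ln (1 + m)], and the excess must be [O(x * y)]. If
   [x <= 1 / 2], it is at most [x * ln (1 + m) <= m * x] and [2 * y >= 1]; otherwise it is at most
   [m * y] and [2 * x >= 1]. *)
have [x2|x2] := leP x 2^-1.
  have : ln (1 + m * y) <= ln (1 + m) by rewrite ler_ln ?posrE; nra.
  have lm : ln (1 + m) <= m by apply: le_ln1Dx; lra.
  have : ln (1 + m) * x <= m * x by rewrite ler_pM2r.
  have : ln (1 + m) = y * ln (1 + m) + ln (1 + m) * x.
    by rewrite -[LHS]mulr1 -xy1; ring.
  have : m * x <= m * x * (2 * y) by apply: ler_peMr; lra.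
  have -> : 2 * m * (x * y) = m * x * (2 * y) by ring.
  lra.
have : ln (1 + m * y) <= m * y by apply: le_ln1Dx; lra.
have -> : 2 * m * (x * y) = m * y * (2 * x) by ring.
have : 0 <= y * ln (1 + m) by rewrite mulr_ge0 // ltW.
nra.
Qed.

(** Since [1 + U i] can be as small as 1, [ln_ge_tangent] would only give a variance error [O(x)];
    [ln_ge_tangent_sqrt] gains the factor [1 / sqrt (1 + u)], as [w] is at least [s0 * (1 + u)]. *)
Lemma mean_ln_uninformed_ge :
  ln (1 + u) - m * x - 2 * m ^+ 2 * (x * y)
    - 4 * V / s0 ^+ 2 * (x / Num.sqrt (1 + u)) <=
  wmean W (fun i => ln (1 + U i)).
Proof.
facts; set w := 1 + u * s.
have us0 : 0 < u * s by rewrite mulr_gt0.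
have w0 : 0 < w by rewrite /w; lra.
have w1 : 1 <= w by rewrite /w; lra.
have u10 : 0 < 1 + u by lra.
set r := Num.sqrt w; set q := Num.sqrt (1 + u).
have r0 : 0 < r by rewrite sqrtr_gt0.
have q0 : 0 < q by rewrite sqrtr_gt0.
have ws : s * (1 + u) <= w by rewrite /w; have := s_lt1; lra.
have ws0 : s0 * (1 + u) <= w by apply: le_trans ws; rewrite ler_pM2r.
(* As [s0 <= 1], the weaker factor [s0] can stand for its square root. *)
have rq : s0 * q <= r.
  have -> : s0 * q = Num.sqrt (s0 ^+ 2 * (1 + u)).
    by rewrite sqrtrM ?sqr_ge0 // sqrtr_sqr ger0_norm // ltW.
  rewrite ler_sqrt // ?(ltW w0) //; apply: le_trans ws0.
  by rewrite ler_pM2r // expr2 ler_piMr // ltW.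
have lnw : ln (1 + u) - m * x - 2 * m ^+ 2 * (x * y) <= ln w.
  have : ln (s * (1 + u)) <= ln w by rewrite ler_ln ?posrE ?mulr_gt0.
  rewrite lnM ?posrE //; have := ln_s_ge.
  have -> : 2 * m ^+ 2 * x * y = 2 * m ^+ 2 * (x * y) by ring.
  lra.
apply: (@le_trans _ _ ((ln w + (1 - w) / w) + w^-1 * wmean W U
      + (- (4 / (w * r))) * wmean W (fun i => (U i - u * s) ^+ 2))); last first.
  apply: wmean_ge_quadratic => // i.
  have Ui0 := U_ge0 i.
  have Ui1 : 1 <= 1 + U i by lra.
  apply: le_trans (ln_ge_tangent_sqrt Ui1 w1).
  rewrite -/r le_eqVlt; apply/orP; left; apply/eqP; rewrite /w.
  by field; rewrite -/w !gt_eqF.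
have -> : ln w + (1 - w) / w + w^-1 * wmean W U = ln w.
  by rewrite U_mean /w; field; rewrite -/w gt_eqF.
rewrite mulNr; apply: lerB => //.
apply: (@le_trans _ _ (4 / (w * r) * (V * (u * x)))).
  by rewrite ler_pM2l ?divr_gt0 ?mulr_gt0 // (mulrA u).
have -> : 4 / (w * r) * (V * (u * x)) = 4 * V * x * (u / w / r).
  by field; rewrite !gt_eqF.
have -> : 4 * V / s0 ^+ 2 * (x / q) = 4 * V * x * (s0^-1 * (s0 * q)^-1).
  by field; rewrite !gt_eqF.
rewrite ler_pM2l ?mulr_gt0 ?invr_gt0 //.
apply: ler_pM.
- by rewrite divr_ge0 ?ltW.
- by rewrite invr_ge0 ltW.
- by rewrite ler_pdivrMr // mulrC ler_pdivlMr //; lra.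
by rewrite lef_pV2 ?posrE ?mulr_gt0.
Qed.

(** The same convexity argument; the factor 4 combines the exponent [1 / 2] with
    [u / (1 + u) >= 1 / 2]. *)
Lemma mean_inv_sqrt_uninformed_ge :
  (Num.sqrt (1 + u))^-1 + a / (4 * (1 + b)) * (x / Num.sqrt (1 + u)) <=
  wmean W (fun i => (Num.sqrt (1 + U i))^-1).
Proof.
facts; set w := 1 + u.
have w0 : 0 < w by rewrite /w; lra.
set r := Num.sqrt w.
have r0 : 0 < r by rewrite sqrtr_gt0.
apply: (@le_trans _ _ (r^-1 * (1 + (w - 1) / (2 * w))
      + (- (r^-1 * (2 * w)^-1)) * wmean W U
      + 0 * wmean W (fun i => (U i - 0) ^+ 2))); last first.
  apply: wmean_ge_quadratic => // i.
  have Ui0 := U_ge0 i.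
  rewrite mul0r addr0; apply: le_trans (inv_sqrt_ge_tangent _ w0); last lra.
  rewrite -/r le_eqVlt; apply/orP; left; apply/eqP.
  by field; rewrite !gt_eqF.
rewrite U_mean mul0r addr0.
have -> : r^-1 * (1 + (w - 1) / (2 * w)) + - (r^-1 * (2 * w)^-1) * (u * s) =
    r^-1 + 2^-1 * (u / w) * (1 - s) / r.
  by rewrite /w; field; rewrite -/w !gt_eqF.
rewrite lerD2l [leLHS]mulrA ler_pM2r ?invr_gt0 //.
have -> : a / (4 * (1 + b)) * x = 4^-1 * (a * x / (1 + b)).
  by field; rewrite gt_eqF //; lra.
have u2 : 2^-1 <= u / w by rewrite ler_pdivlMr // /w; lra.
apply: ler_pM.
- by rewrite invr_ge0.
- by apply/ltW/divr_gt0; [exact: mulr_gt0 | lra].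
- lra.
apply: le_trans s_le_V; rewrite ler_pM2r ?invr_gt0; last lra.
by rewrite ler_pM2r.
Qed.

Let la : K := ln (1 + a).
Let la0 : 0 < la. Proof. by apply: ln_gt0; rewrite ltrDl. Qed.
Let l_ge : la <= ln (1 + m).
Proof. by facts; rewrite ler_ln ?posrE; lra. Qed.
Let l0 : 0 < ln (1 + m). Proof. exact: lt_le_trans l_ge. Qed.
Let b1 : 0 < 1 + b. Proof. by rewrite addr_gt0. Qed.
Let c2_gt0 : 0 < c2.
Proof.
rewrite divr_gt0 ?exprn_gt0 ?divr_gt0 //.
by rewrite !addr_gt0 // exprn_gt0.
Qed.
Let divm (c : K) : 0 <= c -> c / m <= c / a.
Proof. by move=> c0; rewrite ler_wpM2l // lef_pV2. Qed.
Let mean_fraction (D : K) : 0 <= D ->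
  D / n * wmean W U <= D * y - D * (a / (1 + b)) * (x * y).
Proof.
move=> D0; rewrite U_mean.
have -> : D / n * (u * s) = D * y - D * (y * (1 - s)) by ring.
rewrite lerB // -mulrA ler_wpM2l //.
have -> : a / (1 + b) * (x * y) = y * (a * x / (1 + b)) by ring.
rewrite ler_pM2l //; apply: le_trans s_le_V.
by rewrite ler_pM2r ?invr_gt0 // ler_pM2r.
Qed.

(** The two logarithms lose [y] and [x], which add up to 1. Each [D] is the coefficient of one error
    divided by the drift rate of its correction, so [e1], [e2], [e3] make the errors in [x * y],
    [y / k] and [x / (1 + u)] cancel. *)
Lemma super_pot_drift D1 D2 D3 :
  D1 = b / ln (1 + a) / (a / (1 + b)) ->
  D2 = V / ln (1 + a) / c2 ->
  D3 = b / s0 / a / (a / (2 * (1 + b))) ->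
  wmean W (fun i => super_pot D1 D2 D3 m n (U i)) <=
  super_pot D1 D2 D3 m n u - 1.
Proof.
rewrite -/la => D1E D2E D3E; facts.
have aD : 0 < a / (1 + b) by rewrite divr_gt0.
have aD2 : 0 < a / (2 * (1 + b)) by rewrite divr_gt0 // mulr_gt0.
have e1 : D1 * (a / (1 + b)) = b / la by rewrite D1E divfK // gt_eqF.
have e2 : D2 * c2 = V / la by rewrite D2E divfK // gt_eqF.
have e3 : D3 * (a / (2 * (1 + b))) = b / s0 / a by rewrite D3E divfK // gt_eqF.
have D1_ge0 : 0 <= D1 by rewrite D1E !divr_ge0 // ltW.
have D2_ge0 : 0 <= D2 by rewrite D2E; apply/ltW/divr_gt0; first exact: divr_gt0.
have D3_ge0 : 0 <= D3 by rewrite D3E; apply/ltW/divr_gt0; rewrite // !divr_gt0.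
have -> : wmean W (fun i => super_pot D1 D2 D3 m n (U i)) =
    wmean W (fun i => (ln n / ln (1 + m) + D3)
      + (- (ln (1 + m))^-1) * ln (n - U i) + m^-1 * ln (1 + U i)
      + D1 / n * U i + D2 * (n - U i)^-1 + (- D3) * (1 + U i)^-1).
  by apply: eq_wmean => i; rewrite /super_pot; ring.
rewrite !wmeanD !wmeanZ !wmean_cst //.
have h1 : (ln k) / ln (1 + m) + y - b / la * (x * y) - V / la * (y / k) <=
    (ln (1 + m))^-1 * wmean W (fun i => ln (n - U i)).
  rewrite [leRHS]mulrC ler_pdivlMr //; apply: le_trans mean_ln_informed_ge.
  have : m * (x * y) <= b / la * (x * y) * ln (1 + m).
    have -> : b / la * (x * y) * ln (1 + m) = b / la * ln (1 + m) * (x * y) by ring.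
    rewrite ler_pM2r; last exact: mulr_gt0.
    rewrite mulrAC ler_pdivlMr //; apply: ler_pM; by [|exact: ltW].
  have : V * (y / k) <= V / la * (y / k) * ln (1 + m).
    have -> : V / la * (y / k) * ln (1 + m) = V / la * ln (1 + m) * (y / k) by ring.
    rewrite ler_pM2r; last exact: divr_gt0.
    by rewrite mulrAC ler_pdivlMr // ler_pM2l.
  have -> : (ln k / ln (1 + m) + y - b / la * (x * y) - V / la * (y / k)) * ln (1 + m)
    = ln k + y * ln (1 + m) - b / la * (x * y) * ln (1 + m) - V / la * (y / k) * ln (1 + m).
    by field; rewrite !gt_eqF.
  lra.
have h2 : m^-1 * wmean W (fun i => ln (1 + U i)) <=
    ln (1 + u) / m - x + b / s0 / a * (x / (1 + u)).
  rewrite mulrC; apply: (@le_trans _ _ ((ln (1 + u) - m * x + b / s0 * (x / (1 + u))) / m)).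
    by rewrite ler_pM2r ?invr_gt0 //; exact: mean_ln_uninformed_le.
  have -> : (ln (1 + u) - m * x + b / s0 * (x / (1 + u))) / m =
     ln (1 + u) / m - x + b / s0 / m * (x / (1 + u)) by field; rewrite !gt_eqF //; lra.
  rewrite lerD2l ler_pM2r ?divr_gt0 //; last lra.
  by apply: divm; rewrite divr_ge0 ?ltW.
have h3 := mean_fraction D1_ge0.
have h4 : D2 * wmean W (fun i => (n - U i)^-1) <= D2 / k - D2 * c2 * (y / k).
  rewrite -[X in _ - X]mulrA -mulrBr.
  by apply: ler_wpM2l => //; exact: mean_inv_informed_le.
have h5 : D3 * (1 + u)^-1 + D3 * (a / (2 * (1 + b))) * (x / (1 + u)) <=
    D3 * wmean W (fun i => (1 + U i)^-1).
  rewrite -[X in _ + X]mulrA -mulrDr.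
  by apply: ler_wpM2l => //; exact: mean_inv_uninformed_ge.
rewrite e1 in h3; rewrite e2 in h4; rewrite e3 in h5.
rewrite /super_pot (_ : n - u = k); last lra.
rewrite !mulNr [(ln n - ln k) / _]mulrBl [D3 * (1 - _)]mulrBr mulr1.
lra.
Qed.

(** The same cancellation with signs reversed. Both logarithms leave an error in [x * y], hence the
    two summands in [D1]; [D2] absorbs the variance error. *)
Lemma sub_pot_drift D1 D2 :
  D1 = (2 * (b / ln (1 + a)) + 2 * b) / (a / (1 + b)) ->
  D2 = 4 * V / s0 ^+ 2 / a / (a / (4 * (1 + b))) ->
  sub_pot D1 D2 m n u - 1 <= wmean W (fun i => sub_pot D1 D2 m n (U i)).
Proof.
rewrite -/la => D1E D2E; facts.
have aD : 0 < a / (1 + b) by rewrite divr_gt0.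
have aD4 : 0 < a / (4 * (1 + b)) by rewrite divr_gt0 // mulr_gt0.
have e1 : D1 * (a / (1 + b)) = 2 * (b / la) + 2 * b by rewrite D1E divfK // gt_eqF.
have e2 : D2 * (a / (4 * (1 + b))) = 4 * V / s0 ^+ 2 / a by rewrite D2E divfK // gt_eqF.
have D1_ge0 : 0 <= D1.
  rewrite D1E; apply: divr_ge0; last exact: ltW.
  by apply: addr_ge0; rewrite mulr_ge0 ?divr_ge0 // ltW.
have C0 : 0 < 4 * V / s0 ^+ 2 by rewrite divr_gt0 ?mulr_gt0 ?exprn_gt0.
have D2_ge0 : 0 <= D2 by apply/ltW; rewrite D2E divr_gt0 // divr_gt0.
have -> : wmean W (fun i => sub_pot D1 D2 m n (U i)) =
    wmean W (fun i => (ln n / ln (1 + m) - D2)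
      + (- (ln (1 + m))^-1) * ln (n - U i) + m^-1 * ln (1 + U i)
      + (- (D1 / n)) * U i + D2 * (Num.sqrt (1 + U i))^-1).
  by apply: eq_wmean => i; rewrite /sub_pot; ring.
rewrite !wmeanD !wmeanZ !wmean_cst //.
have h1 : (ln (1 + m))^-1 * wmean W (fun i => ln (n - U i)) <=
    (ln k) / ln (1 + m) + y + 2 * (b / la) * (x * y).
  rewrite mulrC ler_pdivrMr //; apply: le_trans mean_ln_informed_le _.
  have : m * (x * y) <= b / la * (x * y) * ln (1 + m).
    have -> : b / la * (x * y) * ln (1 + m) = b / la * ln (1 + m) * (x * y) by ring.
    rewrite ler_pM2r; last exact: mulr_gt0.
    rewrite mulrAC ler_pdivlMr //; apply: ler_pM; by [|exact: ltW].
  have -> : (ln k / ln (1 + m) + y + 2 * (b / la) * (x * y)) * ln (1 + m)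
    = ln k + y * ln (1 + m) + 2 * (b / la * (x * y) * ln (1 + m)).
    by field; rewrite !gt_eqF.
  lra.
have q0 : 0 < Num.sqrt (1 + u) by rewrite sqrtr_gt0; lra.
have h2 : ln (1 + u) / m - x - 2 * b * (x * y) - 4 * V / s0 ^+ 2 / a * (x / Num.sqrt (1 + u)) <=
    m^-1 * wmean W (fun i => ln (1 + U i)).
  rewrite [leRHS]mulrC; apply: (@le_trans _ _ ((ln (1 + u) - m * x - 2 * m ^+ 2 * (x * y)
    - 4 * V / s0 ^+ 2 * (x / Num.sqrt (1 + u))) / m)); last first.
    by rewrite ler_pM2r ?invr_gt0 //; exact: mean_ln_uninformed_ge.
  have -> : (ln (1 + u) - m * x - 2 * m ^+ 2 * (x * y)
      - 4 * V / s0 ^+ 2 * (x / Num.sqrt (1 + u))) / m =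
     ln (1 + u) / m - x - 2 * m * (x * y)
      - 4 * V / s0 ^+ 2 / m * (x / Num.sqrt (1 + u)).
    by field; rewrite !gt_eqF.
  apply: lerB; first rewrite lerD2l lerN2.
    by apply: ler_wpM2r; [exact/ltW/mulr_gt0 | rewrite ler_pM2l].
  by rewrite ler_pM2r ?divr_gt0 //; apply: divm; rewrite ltW.
have h3 := mean_fraction D1_ge0.
have h4 : D2 * (Num.sqrt (1 + u))^-1 + D2 * (a / (4 * (1 + b))) * (x / Num.sqrt (1 + u)) <=
    D2 * wmean W (fun i => (Num.sqrt (1 + U i))^-1).
  rewrite -[X in _ + X]mulrA -mulrDr.
  by apply: ler_wpM2l => //; exact: mean_inv_sqrt_uninformed_ge.
rewrite e1 in h3; rewrite e2 in h4.
rewrite /sub_pot (_ : n - u = k); last lra.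
rewrite !mulNr [(ln n - ln k) / _]mulrBl [D2 * (1 - _)]mulrBr mulr1.
lra.
Qed.

End OneStep.

(** * Bounds on the probability of not being called in a round *)

Section Avoidance.
Variable K : realType.
Implicit Types (q m b : K) (k n : nat).

Lemma bernoulli_le q k : 0 <= q <= 1 -> 1 - k%:R * q <= (1 - q) ^+ k.
Proof.
move=> /andP[q0 q1]; elim: k => [|k IH]; first by rewrite mul0r subr0 expr0.
rewrite exprS; apply: (@le_trans _ _ ((1 - q) * (1 - k%:R * q))).
  rewrite -natr1; have : 0 <= k%:R * q ^+ 2 by rewrite mulr_ge0 ?sqr_ge0.
  by move=> ?; nra.
by rewrite ler_wpM2l // subr_ge0.
Qed.

Lemma expr_1B_le q k : 0 <= q <= 1 -> (1 - q) ^+ k * (1 + k%:R * q) <= 1.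
Proof.
move=> /andP[q0 q1]; elim: k => [|k IH]; first by rewrite mul0r addr0 expr0 mulr1.
rewrite exprSr -mulrA; apply: le_trans IH.
rewrite ler_wpM2l ?exprn_ge0 ?subr_ge0 //.
rewrite -natr1; have : 0 <= k%:R * q ^+ 2 by rewrite mulr_ge0 ?sqr_ge0.
by move=> ?; nra.
Qed.

Lemma expr_le_expr_add (x y d : K) k :
  0 <= x <= 1 -> 0 <= y <= 1 -> 0 <= d -> x <= y + d ->
  x ^+ k <= y ^+ k + k%:R * d.
Proof.
move=> /andP[x0 x1] /andP[y0 y1] d0 xyd.
elim: k => [|k IH]; first by rewrite mul0r addr0.
have yk0 : 0 <= y ^+ k by rewrite exprn_ge0.
have yk1 : y ^+ k <= 1 by rewrite exprn_ile1.
have kd : 0 <= k%:R * d by rewrite mulr_ge0.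
rewrite !exprS -natr1; apply: (@le_trans _ _ (x * (y ^+ k + k%:R * d))).
  by rewrite ler_wpM2l.
move: (y ^+ k) (k%:R * d) (mulrDl k%:R 1 d) yk0 yk1 kd => Y D -> *.
by rewrite mul1r; nra.
Qed.

Lemma ln_1B_ge q : 0 <= q <= 2^-1 -> - q - 2 * q ^+ 2 <= ln (1 - q).
Proof.
move=> /andP[q0 q2].
have q1 : 0 < 1 - q by lra.
have := ln_le_tangent ltr01 q1; rewrite ln1.
have : (1 - (1 - q)) / (1 - q) <= q + 2 * q ^+ 2.
  by rewrite ler_pdivrMr //; nra.
lra.
Qed.

(** These are the hypotheses on [s] of the one-round estimates. The condition [2 * b <= n] gives
    [m / n <= 1 / 2], where [ln (1 - q)] is at least [- q - 2 * q ^ 2]. *)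
Lemma avoidance_bounds m b n k : 0 < m -> m <= b -> (0 < k < n)%N ->
  2 * b <= n%:R ->
  let s := (1 - m / n%:R) ^+ k in let x := k%:R / n%:R in
  [/\ expR (- (2 * b)) <= s, 1 - s <= m * x,
      m * x / (1 + m * x) <= 1 - s, ln s <= - (m * x) &
      - (m * x) - 2 * m ^+ 2 * x * ((n - k)%:R / n%:R) <= ln s].
Proof.
move=> m0 mb /andP[k0 kn] bn s x.
have n0 : 0 < n%:R :> K by rewrite ltr0n (leq_trans _ kn).
set q := m / n%:R.
have q0 : 0 < q by rewrite divr_gt0.
have q2 : q <= 2^-1 by rewrite ler_pdivrMr //; lra.
have q1 : 0 < 1 - q by lra.
have q01 : 0 <= q <= 1 by rewrite ltW //=; lra.
have s0 : 0 < s by rewrite exprn_gt0.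
have kR0 : 0 < k%:R :> K by rewrite ltr0n.
have x0 : 0 < x by rewrite divr_gt0.
have x1 : x <= 1 by rewrite ler_pdivrMr // mul1r ler_nat ltnW.
have kq : k%:R * q = m * x by rewrite mulrCA.
have lnE : ln s = k%:R * ln (1 - q) by rewrite lnXn // mulr_natl.
have mx0 : 0 < m * x by rewrite mulr_gt0.
have ln_ge : - (m * x) - 2 * m ^+ 2 * x * n%:R^-1 <= ln s.
  rewrite lnE; apply: (@le_trans _ _ (k%:R * (- q - 2 * q ^+ 2))).
    rewrite le_eqVlt; apply/orP; left; apply/eqP.
    by rewrite /x /q; field; rewrite gt_eqF.
  by rewrite ler_pM2l // ln_1B_ge // ltW.
split.
- rewrite -[leRHS](lnK s0) ler_expR; apply: le_trans ln_ge.
  have -> : 2 * m ^+ 2 * x * n%:R^-1 = 2 * q * (m * x) by rewrite /q; ring.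
  have : m * x <= m by rewrite ler_piMr // ltW.
  by nra.
- have := bernoulli_le k q01; rewrite kq -/s; lra.
- have := expr_1B_le k q01; rewrite kq -/s => h.
  by rewrite ler_pdivrMr; lra.
- rewrite lnE -kq -[leRHS]mulrN ler_pM2l //; apply: le_ln1Dx; lra.
(* Because [k < n], the factor [1 / n] is at most [(n - k) / n]; this gives the error the form
   [x * y]. *)
apply: le_trans ln_ge; rewrite lerD2l lerN2; apply: ler_wpM2l.
  by rewrite !mulr_ge0 ?sqr_ge0 // ltW.
by rewrite -[leLHS]mul1r ler_pM2r ?invr_gt0 // ler1n subn_gt0.
Qed.

End Avoidance.

(** * The number of nodes left uninformed by one round *)

Definition step (n : nat) (A : {set 'I_n}) (c : 'I_n -> {set 'I_n}) : {set 'I_n} :=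
  A :|: \bigcup_(v in A) c v.

Section OneRound.
Variables (K : realType) (n : nat) (p : nat -> K).
Hypotheses (n_gt1 : (1 < n)%N) (p_ge0 : forall r, 0 <= p r) (pn : p n = 0)
  (p_sum : \sum_(r < n.+1) p r = 1).
Let m : K := \sum_(r < n.+1) r%:R * p r.
Let M2 : K := \sum_(r < n.+1) r%:R ^+ 2 * p r.
Implicit Types (S A B : {set 'I_n}) (v w : 'I_n).

(** In [push_calls_law] only outcomes with [r = #|A|] carry mass, so the called set alone determines
    the probability. *)
Definition call_law S : K := p #|S| * 'C(n, #|S|)%:R^-1.

Definition round_law (c : {ffun 'I_n -> {set 'I_n}}) : K :=
  \prod_v call_law (c v).

Lemma call_law_ge0 S : 0 <= call_law S.
Proof. by rewrite mulr_ge0 ?invr_ge0. Qed.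

Lemma round_law_ge0 c : 0 <= round_law c.
Proof. by apply: prodr_ge0 => v _; exact: call_law_ge0. Qed.

Lemma sum_call_law_subset B :
  \sum_(S : {set 'I_n} | S \subset B) call_law S =
  \sum_(r < n.+1) p r * ('C(#|B|, r)%:R / 'C(n, r)%:R).
Proof.
rewrite (partition_big (fun S : {set 'I_n} => inord #|S| : 'I_n.+1) xpredT) //=.
have cardS S : (inord #|S| : 'I_n.+1) = #|S| :> nat.
  by rewrite inordK // ltnS; apply: leq_trans (max_card _) _; rewrite card_ord.
apply: eq_bigr => r _.
rewrite (eq_bigr (fun=> p r * 'C(n, r)%:R^-1)); last first.
  by move=> S /andP[_ /eqP <-]; rewrite cardS.
rewrite sumr_const -cards_draws -[LHS]mulr_natr mulrAC -mulrA; congr (_ * (_%:R * _)).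
apply: eq_card => S; rewrite [RHS]inE unfold_in -[in RHS]cardS.
by congr (_ && _); exact/esym/val_eqE.
Qed.

Lemma binR_neq0 (r : 'I_n.+1) : 'C(n, r)%:R != 0 :> K.
Proof. by rewrite pnatr_eq0 -lt0n bin_gt0 -ltnS. Qed.

Lemma call_law_sum : \sum_S call_law S = 1.
Proof.
rewrite -p_sum (eq_bigl (fun S => S \subset [set: 'I_n]%SET)) ?sum_call_law_subset.
  by apply: eq_bigr => r _; rewrite cardsT card_ord divff ?mulr1 // binR_neq0.
by move=> S; rewrite finset.subsetT.
Qed.

Lemma mean_mul_bool (P : pred {set 'I_n}) :
  \sum_S call_law S * (P S)%:R = \sum_(S | P S) call_law S.
Proof.
rewrite [RHS]big_mkcond; apply: eq_bigr => S _.
by case: (P S); rewrite ?mulr1 ?mulr0.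
Qed.

Let nR0 : n%:R != 0 :> K. Proof. by rewrite pnatr_eq0 -lt0n ltnW. Qed.
Let n1R0 : n.-1%:R != 0 :> K.
Proof. by rewrite pnatr_eq0 -lt0n -ltnS prednK // ltnW. Qed.

Lemma subset_setC1 S v : (S \subset ~: [set v]%SET) = (v \notin S).
Proof. by rewrite -finset.disjoints_subset disjoint_sym disjoints1. Qed.

Lemma sum_avoid1 v : \sum_S call_law S * (v \notin S)%:R = 1 - m / n%:R.
Proof.
rewrite mean_mul_bool (eq_bigl (fun S => S \subset ~: [set v]%SET)); last first.
  by move=> S; rewrite subset_setC1.
rewrite sum_call_law_subset cardsC1 card_ord -[X in X - _]p_sum /m mulr_suml -sumrB.
apply: eq_bigr => r _.
have /(congr1 (fun k => k%:R : K)) := mul_bin_down n r.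
rewrite !natrM natrB -1?ltnS // => e.
have -> : 'C(n.-1, r)%:R = (n%:R - r%:R) * 'C(n, r)%:R / n%:R :> K.
  by rewrite -e mulrC mulKf.
by field; rewrite nR0 binR_neq0.
Qed.

(** Given size [r], both nodes are avoided with probability [(n - r) * (n - 1 - r) / (n * (n - 1))];
    expanding in [r] brings in the first two moments. *)
Lemma sum_avoid2 v w : v != w ->
  \sum_S call_law S * ((v \notin S)%:R * (w \notin S)%:R) =
  1 - m * (2 * n%:R - 1) / (n%:R * (n%:R - 1)) + M2 / (n%:R * (n%:R - 1)).
Proof.
move=> vw; rewrite (eq_bigr (fun S => call_law S *
    ((v \notin S) && (w \notin S))%:R)); last first.
  by move=> S _; case: (v \notin S); rewrite ?mul1r ?mul0r.
rewrite mean_mul_bool (eq_bigl (fun S => S \subset ~: [set v; w]%SET)); last first.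
  by move=> S; rewrite finset.setCU finset.subsetI !subset_setC1.
rewrite sum_call_law_subset.
have -> : #|~: [set v; w]%SET| = n.-1.-1.
  by rewrite cardsCs finset.setCK cards2 vw card_ord -!subn1 -subnDA.
have n1E : n.-1%:R = n%:R - 1 :> K.
  by rewrite -subn1 natrB // ltnW.
have n10 : n%:R - 1 != 0 :> K by rewrite -n1E.
rewrite -[X in X - _ + _]p_sum /m /M2 -mulrA !mulr_suml -sumrB -big_split /=.
apply: eq_bigr => r _.
(* The term [r = n] vanishes by [pn]; in all others [r <= n.-1], so the natural subtraction in the
   second use of [mul_bin_down] does not truncate. *)
have [rn|rn] := eqVneq (r : nat) n; first by rewrite rn pn !(mul0r, mulr0, subr0, addr0).
have rn1 : (r <= n.-1)%N by rewrite -ltnS prednK ?(ltnW n_gt1) // ltn_neqAle rn -ltnS ltn_ord.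
have /(congr1 (fun k => k%:R : K)) := mul_bin_down n r.
rewrite !natrM natrB -1?ltnS // => e.
have /(congr1 (fun k => k%:R : K)) := mul_bin_down n.-1 r.
rewrite !natrM natrB // n1E => e'.
have -> : 'C(n.-2, r)%:R =
    (n%:R - 1 - r%:R) * ((n%:R - r%:R) * 'C(n, r)%:R / n%:R) / (n%:R - 1) :> K.
  by rewrite -e (mulrC n%:R) mulfK // -e' mulrC mulKf.
by field; rewrite nR0 n10 binR_neq0.
Qed.

(** Independence of the callers: the mean of a product of functions of the single calls factors. *)
Lemma round_law_prod (g : 'I_n -> {set 'I_n} -> K) :
  wmean round_law (fun c => \prod_v g v (c v)) =
  \prod_v \sum_S call_law S * g v S.
Proof.
rewrite bigA_distr_bigA; apply: eq_bigr => c _.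
by rewrite /round_law -big_split.
Qed.

Lemma round_law_sum : \sum_c round_law c = 1.
Proof.
have <- : \prod_(v < n) \sum_S call_law S * 1 = 1.
  by rewrite big1 // => v _; under eq_bigr do rewrite mulr1; exact: call_law_sum.
rewrite -(round_law_prod (fun _ _ => 1)).
by apply: eq_bigr => c _; rewrite big1 ?mulr1.
Qed.

(** The product runs over all nodes, with factor 1 for the uninformed ones, to fit
    [round_law_prod]. *)
Lemma notin_step A c v : v \notin A ->
  (v \notin step A c)%:R =
  \prod_w (if w \in A then (v \notin c w)%:R else 1) :> K.
Proof.
move=> vA; rewrite finset.in_setU negb_or vA /=.
case: (boolP (v \in (\bigcup_(w in A) c w)%SET)) => [/finset.bigcupP[w wA vcw]|h].
  by rewrite (bigD1 w) //= wA vcw mul0r.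
rewrite big1 // => w _; case: ifP => // wA.
by case: (boolP (v \in c w)) => // vcw; case/negP: h; apply/finset.bigcupP; exists w.
Qed.

Lemma card_not_step A c : #|~: step A c|%:R =
  \sum_(v | v \notin A) (v \notin step A c)%:R :> K.
Proof.
rewrite -sum1_card natr_sum big_mkcond [RHS]big_mkcond; apply: eq_bigr => v _ /=.
rewrite !inE negb_or; case: (v \in A) => //=.
by case: (v \in _).
Qed.

Lemma prod_if A (x : K) : \prod_w (if w \in A then x else 1) = x ^+ #|A|.
Proof. by rewrite -big_mkcond prodr_const. Qed.

Lemma wmean_sum (J : finType) (P : pred J) (X : J -> {ffun 'I_n -> {set 'I_n}} -> K) :
  wmean round_law (fun c => \sum_(j | P j) X j c) =
  \sum_(j | P j) wmean round_law (X j).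
Proof. by rewrite /wmean exchange_big; apply: eq_bigr => c _; rewrite mulr_sumr. Qed.

Lemma mean_uninformed A :
  wmean round_law (fun c => #|~: step A c|%:R) =
  #|~: A|%:R * (1 - m / n%:R) ^+ #|A|.
Proof.
under eq_wmean do rewrite card_not_step.
rewrite wmean_sum (eq_bigr (fun=> (1 - m / n%:R) ^+ #|A|)) => [|v vA].
  rewrite sumr_const -[LHS]mulr_natl; congr (_%:R * _).
  by apply: eq_card => v; rewrite !inE.
under eq_wmean do rewrite notin_step //.
rewrite (round_law_prod (fun w S => if w \in A then (v \notin S)%:R else 1)).
rewrite -prod_if; apply: eq_bigr => w _; case: ifP => _; first exact: sum_avoid1.
by under eq_bigr do rewrite mulr1; exact: call_law_sum.
Qed.

(** The square is a sum over ordered pairs of uninformed nodes: the [u] diagonal pairs give [s], the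
    others [p2 ^+ #|A|], where [p2] is the probability that one call avoids two given nodes. *)
Lemma mean_uninformed_sqr A :
  let p2 := 1 - m * (2 * n%:R - 1) / (n%:R * (n%:R - 1)) + M2 / (n%:R * (n%:R - 1)) in
  let s := (1 - m / n%:R) ^+ #|A| in let u := #|~: A|%:R in
  wmean round_law (fun c => #|~: step A c|%:R ^+ 2) =
  u * s + (u ^+ 2 - u) * p2 ^+ #|A|.
Proof.
move=> p2 s u.
under eq_wmean do rewrite expr2 {1}card_not_step mulr_suml.
rewrite wmean_sum (eq_bigr (fun=> s + (u - 1) * p2 ^+ #|A|)) => [|v vA].
  rewrite sumr_const -mulr_natl.
  have -> : #|[pred v | v \notin A]|%:R = u.
    by congr (_%:R); apply: eq_card => v; rewrite !inE.
  ring.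
under eq_wmean do rewrite card_not_step mulr_sumr.
rewrite wmean_sum.
rewrite (eq_bigr (fun w => p2 ^+ #|A| + (if w == v then s - p2 ^+ #|A| else 0))) => [|w wA].
  rewrite big_split /= sumr_const -mulr_natl.
  have -> : #|[pred v | v \notin A]|%:R = u.
    by congr (_%:R); apply: eq_card => w; rewrite !inE.
  rewrite (bigD1 v) //= eqxx big1 ?addr0 => [|w /andP[_ /negPf ->] //].
  ring.
under eq_wmean do rewrite !notin_step // -big_split /=.
pose g w' S : K := (if w' \in A then (v \notin S)%:R else 1) *
   (if w' \in A then (w \notin S)%:R else 1).
rewrite (round_law_prod g) /g.
have [->|wv] := eqVneq w v.
  rewrite addrC subrK /s -prod_if; apply: eq_bigr => w' _; case: ifP => _.
    rewrite -(sum_avoid1 v); apply: eq_bigr => S _.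
    by case: (v \in S); rewrite ?mulr1 ?mul0r.
  by under eq_bigr do rewrite !mulr1; exact: call_law_sum.
rewrite addr0 -prod_if; apply: eq_bigr => w' _; case: ifP => _.
  by rewrite (@sum_avoid2 v w) // eq_sym.
by under eq_bigr do rewrite !mulr1; exact: call_law_sum.
Qed.

(** Near-independence of two nodes: [p2] exceeds [(1 - m / n) ^ 2] by at most [2 * V / n ^ 2], hence
    its power exceeds [s ^ 2] by at most [#|A|] times that. The off-diagonal part costs [2 * V] in
    the constant, the diagonal part [b]. *)
Lemma var_uninformed A (b V : K) : 0 < m -> m <= b -> M2 <= V -> b <= n%:R ->
  wmean round_law (fun c => (#|~: step A c|%:R
    - #|~: A|%:R * (1 - m / n%:R) ^+ #|A|) ^+ 2) <=
  (b + 2 * V) * (#|~: A|%:R * #|A|%:R / n%:R).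
Proof.
move=> m0 mb MV bn; set u : K := #|~: A|%:R; set k : K := #|A|%:R.
set s := (1 - m / n%:R) ^+ #|A|.
pose p2 := 1 - m * (2 * n%:R - 1) / (n%:R * (n%:R - 1)) + M2 / (n%:R * (n%:R - 1)).
have n0 : 0 < n%:R :> K by rewrite ltr0n ltnW.
have n2 : 2 <= n%:R :> K by rewrite ler_nat.
have M20 : 0 <= M2 by apply: sumr_ge0 => r _; rewrite mulr_ge0 ?sqr_ge0.
have V0 : 0 <= V by apply: le_trans MV.
have q0 : 0 < m / n%:R by rewrite divr_gt0.
have q1 : m / n%:R <= 1 by rewrite ler_pdivrMr // mul1r; lra.
have sqr_mean : wmean round_law (fun c => #|~: step A c|%:R ^+ 2) =
    u * s + (u ^+ 2 - u) * p2 ^+ #|A| by exact: mean_uninformed_sqr.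
have := @wmean_sqr_shift _ _ _ round_law_sum _ _ 0 (mean_uninformed A).
under eq_wmean do rewrite subr0.
rewrite sqr_mean subr0 -/u -/s => /eqP; rewrite -subr_eq => /eqP <-.
have s1 : 1 - s <= m / n%:R * k.
  have := @bernoulli_le _ (m / n%:R) #|A|; rewrite ltW //= q1 => /(_ isT).
  by rewrite -/s /k; lra.
have s0 : 0 <= s by rewrite exprn_ge0 // subr_ge0.
have s_le1 : s <= 1 by rewrite exprn_ile1 ?subr_ge0 // gerBl ltW.
have u0 : 0 <= u by [].
have k0 : 0 <= k by [].
have p2_le : p2 <= (1 - m / n%:R) ^+ 2 + 2 * V / n%:R ^+ 2.
  have -> : p2 = (1 - m / n%:R) ^+ 2 - m / (n%:R * (n%:R - 1)) - m ^+ 2 / n%:R ^+ 2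
      + M2 / (n%:R * (n%:R - 1)).
    by rewrite /p2; field; rewrite !gt_eqF //; lra.
  have : 0 <= m / (n%:R * (n%:R - 1)) by rewrite divr_ge0 ?mulr_ge0 //; lra.
  have : 0 <= m ^+ 2 / n%:R ^+ 2 by rewrite divr_ge0 ?sqr_ge0.
  have : M2 / (n%:R * (n%:R - 1)) <= 2 * V / n%:R ^+ 2.
    have -> : 2 * V / n%:R ^+ 2 = V / (n%:R * (n%:R / 2)) by field; rewrite gt_eqF.
    apply: ler_pM => //; first by rewrite invr_ge0 mulr_ge0 //; lra.
    by rewrite lef_pV2 ?posrE ?mulr_gt0 ?ler_pM2l //; lra.
  lra.
(* As the probability that a call avoids the nodes 0 and 1, [p2] lies between 0 and 1. *)
have [p2_ge0 p2_le1] : 0 <= p2 /\ p2 <= 1.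
  have -> : p2 = \sum_S call_law S * ((Ordinal (ltnW n_gt1) \notin S)%:R *
      (Ordinal n_gt1 \notin S)%:R) by rewrite sum_avoid2.
  split; first by rewrite sumr_ge0 // => S _; rewrite !mulr_ge0 // call_law_ge0.
  rewrite -[leRHS]call_law_sum; apply: ler_sum => S _.
  apply: ler_piMr; first exact: call_law_ge0.
  by rewrite -natrM lern1; case: (_ \notin S); case: (_ \notin S).
have p2s : p2 ^+ #|A| <= s ^+ 2 + k * (2 * V / n%:R ^+ 2).
  rewrite /s -exprM mulnC exprM; apply: expr_le_expr_add => //.
  - by rewrite p2_ge0.
  - by rewrite sqr_ge0 exprn_ile1 ?subr_ge0 // gerBl ltW.
  - by rewrite divr_ge0 ?mulr_ge0 ?sqr_ge0.
have uu : 0 <= u ^+ 2 - u.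
  rewrite subr_ge0 /u expr2 -natrM ler_nat; case: #|_| => // j.
  by rewrite leq_pmulr.
have un : u <= n%:R by rewrite ler_nat; apply: leq_trans (max_card _) _; rewrite card_ord.
apply: (@le_trans _ _ (u * (1 - s) + u ^+ 2 * (k * (2 * V / n%:R ^+ 2)))).
  have h1 : 0 <= k * (2 * V / n%:R ^+ 2) by rewrite mulr_ge0 // divr_ge0 ?mulr_ge0 ?sqr_ge0.
  have h2 := ler_wpM2l uu p2s.
  have h3 : 0 <= u * (1 - s) ^+ 2 by rewrite mulr_ge0 ?sqr_ge0.
  have h4 : 0 <= u * (k * (2 * V / n%:R ^+ 2)) by rewrite mulr_ge0.
  move: (k * _) h1 h2 h4 => D h1 h2 h4; nra.
have h1 := ler_wpM2l u0 s1.
have h2 : u * (m / n%:R * k) <= b * (u * k / n%:R).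
  have -> : u * (m / n%:R * k) = m * (u * k / n%:R) by ring.
  by apply: ler_wpM2r => //; rewrite divr_ge0 ?mulr_ge0.
have h3 : u ^+ 2 * (k * (2 * V / n%:R ^+ 2)) <= 2 * V * (u * k / n%:R).
  have -> : u ^+ 2 * (k * (2 * V / n%:R ^+ 2)) =
    (2 * V * (u * k / n%:R)) * (u / n%:R) by field; rewrite gt_eqF.
  apply: ler_piMr; last by rewrite ler_pdivrMr // mul1r.
  by rewrite !mulr_ge0 // ?invr_ge0 ltW.
lra.
Qed.

End OneRound.

(** * The law of the informed set *)

(** The law of the informed set as a finite Markov chain. It depends on [p] only, so the time bounds
    can be proved by finite sums, away from the probability space. *)
Fixpoint informed_law (K : realType) (n : nat) (p : nat -> K) (start : 'I_n)
    (t : nat) (A : {set 'I_n}) : K :=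
  if t is t'.+1 then
    \sum_(Bc : {set 'I_n} * {ffun 'I_n -> {set 'I_n}} | step Bc.1 Bc.2 == A)
      informed_law p start t' Bc.1 * round_law p Bc.2
  else (A == [set start]%SET)%:R.

Section Events.
Variables (K : realType) (d : measure_display) (T : measurableType d)
  (P : probability T K).

(** The target [I] carries no sigma-algebra: measurability and measure of [E] are obtained by
    cutting it into finitely many disjoint fibres of [f]. *)
Lemma measure_fibres (I : finType) (Q : pred I) (f : T -> I) (E : set T) :
  (forall i, measurable (E `&` [set w | f w = i])) ->
  (forall w, E w -> Q (f w)) ->
  measurable E /\ P E = (\sum_(i | Q i) P (E `&` [set w | f w = i]))%E.
Proof.
move=> mE EQ.
have EE : E = \bigcup_(i in [set` Q]) (E `&` [set w | f w = i]).
  apply/seteqP; split => [w Ew|w [i _ [Ew _]] //].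
  by exists (f w) => //; exact: EQ.
have fQ : finite_set [set` Q] by exact: finite_finpred.
split; first by rewrite EE; apply: fin_bigcup_measurable.
rewrite {1}EE measure_fin_bigcup //; last first.
  by move=> i j _ _ [w [[_ /= <-] [_ /= <-]]].
rewrite fsbig_finite // -[RHS]big_filter; apply: perm_big; apply: uniq_perm.
- exact: fset_uniq.
- by rewrite filter_uniq // index_enum_uniq.
move=> i; rewrite in_fset_set // mem_filter mem_index_enum andbT.
by apply/idP/idP; rewrite inE.
Qed.

End Events.

Section ProcessLaw.
Variables (K : realType) (dR : measure_display) (TR : measurableType dR)
  (PR : probability TR K) (R : TR -> K) (n : nat)
  (d : measure_display) (T : measurableType d) (P : probability T K)
  (draw : nat -> 'I_n -> T -> nat) (call : nat -> 'I_n -> T -> {set 'I_n})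
  (start : 'I_n).
Hypothesis R_fibre_measurable : forall r : nat, measurable [set x | R x = r%:R].
Hypothesis callsP : push_calls PR R P draw call.

Local Notation p := (fun r : nat => fine (PR [set x | R x = r%:R])).

(** The hypotheses speak of draw and call jointly. The marginal event is a countable union over the
    drawn number, in which only the part with number [#|S|] is not null. *)
Lemma call_event (t : nat) (v : 'I_n) (S : {set 'I_n}) :
  measurable [set w | call t v w = S] /\
  P [set w | call t v w = S] = (call_law p S)%:E.
Proof.
pose D r := [set w | draw t v w = r /\ call t v w = S].
have mD r : measurable (D r) by exact: (push_calls_measurable callsP).
pose D' r := if r == #|S| then set0 else D r.
have mD' r : measurable (D' r) by rewrite /D'; case: ifP.
have mU : measurable (\bigcup_r D' r) by apply: bigcup_measurable.
have -> : [set w | call t v w = S] = D #|S| `|` \bigcup_r D' r.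
  apply/seteqP; split => [w /= wS|w [[]//|[r _]]]; last first.
    by rewrite /D'; case: ifP => // _ [].
  have [e|ne] := eqVneq (draw t v w) #|S|; [by left | right].
  by exists (draw t v w) => //; rewrite /D' (negPf ne).
split; first exact: measurableU.
rewrite measureU0 //; last first.
  apply: measure_negligible => //; apply: negligible_bigcup => r.
  apply/negligibleP => //; rewrite /D'; case: eqP => [_|/eqP ne]; first exact: measure0.
  by have := push_calls_law callsP t v r S; rewrite eq_sym (negPf ne).
apply: etrans (push_calls_law callsP t v #|S| S) _; rewrite eqxx.
by rewrite -[X in (X * _)%E]fineK ?fin_num_measure // -EFinM.
Qed.

Let calls_from t j (c : nat -> 'I_n -> {set 'I_n}) : set T :=
  [set w | forall s v, (t <= s < t + j)%N -> call s v w = c s v].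

Lemma calls_from_law j (c : nat -> 'I_n -> {set 'I_n}) :
  measurable (calls_from 0 j c) /\
  P (calls_from 0 j c) = (\prod_(s < j) \prod_v call_law p (c s v))%:E.
Proof.
pose J : {fset nat * 'I_n} :=
  [fset sv in [seq (s, v) | s <- iota 0 j, v <- index_enum 'I_n]]%fset.
have JE sv : (sv \in J) = (sv.1 < j)%N.
  rewrite in_fset /=; apply/allpairsP/idP => [[[s v] /= [+ _ ->]]|svj].
    by rewrite mem_iota.
  by exists sv; split; rewrite ?mem_iota ?mem_index_enum //; case: (sv).
have := push_calls_independent callsP J (fun sv => [set x | x.2 = c sv.1 sv.2]).
have E : calls_from 0 j c = \bigcap_(i in [set` J])
    (fun w => (draw i.1 i.2 w, call i.1 i.2 w)) @^-1` [set x | x.2 = c i.1 i.2].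
  apply/seteqP; split => w /= h.
    by move=> [s v]; rewrite /= JE /= => sj; apply: h; rewrite add0n.
  by move=> s v; rewrite add0n /= => sj; apply: (h (s, v)); rewrite /= JE.
rewrite -E => ->; split.
  rewrite E bigcap_fset; apply: bigsetI_measurable => -[s v] _.
  exact: (call_event s v _).1.
rewrite (eq_bigr (fun i => (call_law p (c i.1 i.2))%:E)); last first.
  by move=> sv _; rewrite -(call_event sv.1 sv.2 _).2.
rewrite prodEFin; congr EFin.
rewrite (@perm_big _ _ _ _ _ [seq (s, v) | s <- iota 0 j, v <- index_enum 'I_n]).
  by rewrite big_allpairs -{1}[j]subn0 -/(index_iota 0 j) big_mkord.
apply: uniq_perm; first exact: fset_uniq.
  by apply: allpairs_uniq; rewrite ?iota_uniq ?index_enum_uniq // => -[? ?] [? ?].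
by move=> sv; rewrite in_fset.
Qed.

Lemma informed_stepE t w :
  informed start call t.+1 w = step (informed start call t w) (fun v => call t v w).
Proof. by []. Qed.

(* Including the calls of the next [j] rounds makes the induction on [t] work. *)
Lemma informed_calls_law t A j c :
  measurable ([set w | informed start call t w = A] `&` calls_from t j c) /\
  P ([set w | informed start call t w = A] `&` calls_from t j c) =
  (informed_law p start t A * \prod_(i < j) \prod_v call_law p (c (t + i)%N v))%:E.
Proof.
elim: t A j c => [|t IH] A j c.
  rewrite /=; case: eqP => [->|ne].
    have -> : [set w : T | [set start]%SET = [set start]%SET] = setT.
      by apply/seteqP; split.
    rewrite setTI mul1r; under eq_bigr do under eq_bigr do rewrite add0n.
    exact: calls_from_law.
  have -> : [set w : T | [set start]%SET = A] = set0.
    by apply/seteqP; split => // w /= e; case: ne.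
  by rewrite set0I mul0r measure0.
(* With [c'] prescribing the calls [x] in round [t], the event at [t.+1] with [j] further rounds
   splits, over the previous set and [x], into events at [t] with [j.+1] further rounds. *)
pose c' (x : {ffun 'I_n -> {set 'I_n}}) s v := if s == t then x v else c s v.
pose f w : {set 'I_n} * {ffun 'I_n -> {set 'I_n}} :=
  (informed start call t w, [ffun v => call t v w]).
set E := _ `&` _.
have fE Bx w : f w = Bx -> informed start call t.+1 w = step Bx.1 Bx.2.
  by move=> <-; rewrite informed_stepE /step /=; under [in RHS]eq_bigr do rewrite ffunE.
have E1 (Bx : {set 'I_n} * {ffun 'I_n -> {set 'I_n}}) :
  step Bx.1 Bx.2 = A -> E `&` [set w | f w = Bx] =
    [set w | informed start call t w = Bx.1] `&` calls_from t j.+1 (c' Bx.2).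
  move=> BxA; apply/seteqP; split => [w [[_ /= cw] fw]|w [/= iw cw]].
    split; first by rewrite /= -fw.
    move=> s v /andP[ts sj]; rewrite /c'; case: eqP => [->|/eqP st].
      by rewrite -fw ffunE.
    by apply: cw; rewrite ltn_neqAle eq_sym st ts addSnnS.
  have fw : f w = Bx.
    case: Bx {BxA} iw cw => B x /= iw cw; rewrite /f iw; congr pair.
    apply/ffunP => v; rewrite ffunE (cw t v) /c' ?eqxx //.
    by rewrite leqnn addnS ltnS leq_addr.
  split=> //; split => /=; first by rewrite -[_ :|: _]/(informed start call t.+1 w) (fE Bx).
  move=> s v /andP[ts sj]; rewrite cw /c' ?(gtn_eqF ts) //.
  by rewrite (ltnW ts) addnS -addSn.
have E0 (Bx : {set 'I_n} * {ffun 'I_n -> {set 'I_n}}) :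
  step Bx.1 Bx.2 != A -> E `&` [set w | f w = Bx] = set0.
  move=> /eqP BxA; apply/seteqP; split => // w [[/= iw _] fw]; apply: BxA.
  by rewrite -(fE _ w).
have [||mE ->] := @measure_fibres _ _ _ P _ 
  (fun Bx : {set 'I_n} * {ffun 'I_n -> {set 'I_n}} => step Bx.1 Bx.2 == A) f E.
- move=> Bx; have [/E1 ->|/E0 ->//] := eqVneq (step Bx.1 Bx.2) A.
  exact: (IH _ _ _).1.
- by move=> w [iw _]; apply/eqP; rewrite -iw; apply/esym/fE.
split=> //; rewrite mulr_suml -sumEFin; apply: eq_bigr => Bx /eqP /E1 ->.
rewrite (IH _ _ _).2 big_ord_recl -mulrA /=; congr (_ * (_ * _))%:E.
  by apply: eq_bigr => v _; rewrite addn0 /c' eqxx.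
apply: eq_bigr => i _; apply: eq_bigr => v _.
by rewrite /c' /bump /= add1n -addSnnS gtn_eqF // ltnS leq_addr.
Qed.

Lemma informed_eventP t A :
  measurable [set w | informed start call t w = A] /\
  P [set w | informed start call t w = A] = (informed_law p start t A)%:E.
Proof.
have := informed_calls_law t A 0 (fun _ _ => @finset.set0 'I_n).
have -> : calls_from t 0 (fun _ _ => @finset.set0 'I_n) = setT.
  by apply/seteqP; split => // w _ s v; rewrite addn0 => /andP[ts]; rewrite ltnNge ts.
by rewrite setIT big_ord0 mulr1.
Qed.

Lemma not_informed_eventP t :
  measurable [set w | informed start call t w != [set: 'I_n]%SET] /\
  P [set w | informed start call t w != [set: 'I_n]%SET] =
  (\sum_(A | A != [set: 'I_n]%SET) informed_law p start t A)%:E.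
Proof.
set E := [set w | _].
have [||mE ->] := @measure_fibres _ _ _ P _ (fun A => A != [set: 'I_n]%SET)
    (informed start call t) E; last first.
- split=> //; rewrite -sumEFin; apply: eq_bigr => A AT.
  rewrite -(informed_eventP t A).2; congr (P _); apply/seteqP; split => w /=; first by case.
  by move=> wA; split => //; rewrite /E /= wA.
- by [].
move=> A; have [AT|AT] := eqVneq A [set: 'I_n]%SET.
  rewrite (_ : E `&` _ = set0) //; apply/seteqP; split => // w [/= /eqP ne wA].
  by apply: ne; rewrite wA.
rewrite (_ : E `&` _ = [set w | informed start call t w = A]).
  exact: (informed_eventP t A).1.
by apply/seteqP; split => w /=; [case | move=> wA; split => //; rewrite /E /= wA].
Qed.

End ProcessLaw.

(** * Moments of a random variable with finitely many natural values *)

Section NaturalMoments.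
Variables (K : realType) (d : measure_display) (T : measurableType d)
  (P : probability T K) (R : {RV P >-> K}) (n : nat).
Hypothesis R_range : forall x, exists2 k : nat, (k < n)%N & R x = k%:R.
Local Open Scope ereal_scope.

Local Notation p := (fun r : nat => fine (P [set x | R x = r%:R])).

Lemma fibre_measurable (r : nat) : measurable [set x | R x = r%:R].
Proof. exact: (measurable_funPTI R (measurable_set1 r%:R)). Qed.

(** The function [f] of [R] is a finite combination of indicators of fibres. The index [r = n] is
    included, with weight 0, to match the sums over set sizes. *)
Lemma integral_natural (f : K -> K) : (forall r : nat, 0 <= f r%:R)%R ->
  \int[P]_x (f (R x))%:E = (\sum_(r < n.+1) f r%:R * p r)%:E.
Proof.
move=> f0.
rewrite (eq_integral (fun x => \sum_(r < n.+1)
    (f r%:R)%:E * (\1_[set x | R x = r%:R] x)%:E)); last first.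
  move=> x _; have [k kn Rx] := R_range x.
  rewrite (bigD1 (Ordinal (ltnW kn : k < n.+1)%N)) //= big1 => [|r rk].
    by rewrite indicE mem_set // mule1 adde0 Rx.
  rewrite indicE memNset ?mule0 //= Rx => /eqP; rewrite eqr_nat => /eqP kr.
  by case/eqP: rk; apply: val_inj; rewrite /= kr.
have mE (r : nat) : measurable_fun setT (EFin \o (\1_[set x | R x = r%:R] : T -> K)).
  by apply/measurable_EFinP; apply: measurable_indic; exact: fibre_measurable.
rewrite ge0_integral_sum //.
- rewrite -sumEFin; apply: eq_bigr => r _.
  rewrite ge0_integralZl_EFin //; last exact: mE.
  rewrite integral_indic //; last exact: fibre_measurable.
  by rewrite setIT EFinM fineK // fin_num_measure //; exact: fibre_measurable.
- by move=> r; apply: emeasurable_funM => //; exact: mE.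
- by move=> r x _; rewrite mule_ge0 // lee_fin ?indicE.
Qed.

Lemma natural_law_ge0 (r : nat) : (0 <= p r)%R.
Proof. exact: fine_ge0. Qed.

Lemma natural_law_outside : p n = 0%R.
Proof.
have -> : [set x | R x = n%:R] = set0.
  apply/seteqP; split => // x /=; have [k kn ->] := R_range x.
  by move/eqP; rewrite eqr_nat => /eqP e; rewrite e ltnn in kn.
by rewrite measure0.
Qed.

Lemma natural_law_sum : (\sum_(r < n.+1) p r = 1)%R.
Proof.
have := @integral_natural (fun=> 1%R) (fun=> ler01).
under [in X in _ = X -> _]eq_bigr do rewrite mul1r.
rewrite integral_cst // mul1e => /(congr1 fine) /= <-.
by rewrite (probability_setT P).
Qed.

Lemma natural_mean : 'E_P[R] = (\sum_(r < n.+1) r%:R * p r)%:E.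
Proof. by rewrite expectation_def (@integral_natural id). Qed.

Lemma natural_second_moment (c b : K) :
  'V_P[R] <= c%:E -> 'E_P[R] <= b%:E ->
  (\sum_(r < n.+1) r%:R ^+ 2 * p r <= c + b ^+ 2)%R.
Proof.
rewrite /variance covariance.unlock natural_mean /= => Vc; rewrite lee_fin => mb.
set m := (\sum_(r < n.+1) _)%R in Vc mb.
have m0 : (0 <= m)%R by apply: sumr_ge0 => r _; rewrite mulr_ge0 // natural_law_ge0.
move: Vc; rewrite unlock (@integral_natural (fun x => (x - m) * (x - m))%R); last first.
  by move=> r; rewrite -expr2 sqr_ge0.
rewrite lee_fin => Vc.
have -> : (\sum_(r < n.+1) r%:R ^+ 2 * p r =
    \sum_(r < n.+1) (r%:R - m) * (r%:R - m) * p r + m ^+ 2)%R.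
  have -> : (m ^+ 2 = \sum_(r < n.+1) (2 * m * (r%:R * p r) - m ^+ 2 * p r))%R.
    by rewrite sumrB -!mulr_sumr natural_law_sum -/m; ring.
  by rewrite -big_split; apply: eq_bigr => r _ /=; ring.
by rewrite lerD // ler_sqr ?nnegrE // (le_trans m0).
Qed.

End NaturalMoments.

(** * Hitting-time bounds from super- and sub-solutions *)

Section ChainTime.
Variables (K : realType) (n : nat) (p : nat -> K) (start : 'I_n).
Hypotheses (p_ge0 : forall r, 0 <= p r) (p_sum : \sum_(r < n.+1) p r = 1).
Implicit Types (A B : {set 'I_n}) (F : {set 'I_n} -> K).

Local Notation law := (informed_law p start).
Local Notation full := [set: 'I_n]%SET.

Definition mean_at F t : K := \sum_A law t A * F A.
(** This is the tail probability that the spreading time exceeds [t]; its sum over [t] is the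
    expected time. *)
Definition unfinished t : K := \sum_(A | A != full) law t A.

Lemma informed_law_ge0 t A : 0 <= law t A.
Proof.
elim: t A => [|t IH] A /=; first by [].
by apply: sumr_ge0 => Bc _; rewrite mulr_ge0 // round_law_ge0.
Qed.

Lemma informed_law_start t A : start \notin A -> law t A = 0.
Proof.
elim: t A => [|t IH] A sA /=.
  by case: eqP sA => // ->; rewrite finset.in_set1 eqxx.
apply: big1 => -[B c] /= /eqP BA; rewrite IH ?mul0r //.
by apply: contra sA => sB; rewrite -BA finset.in_setU sB.
Qed.

Lemma mean_atS F t :
  mean_at F t.+1 = \sum_B law t B * wmean (round_law p) (fun c => F (step B c)).
Proof.
rewrite /mean_at /=; under eq_bigr do rewrite mulr_suml.
under [RHS]eq_bigr do rewrite mulr_sumr.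
rewrite pair_big [RHS](partition_big (fun Bc : {set 'I_n} * {ffun 'I_n -> {set 'I_n}} =>
  step Bc.1 Bc.2) xpredT) //=.
apply: eq_bigr => A _; apply: eq_bigr => -[B c] /= /eqP <-.
by rewrite mulrA.
Qed.

Lemma step_full (c : 'I_n -> {set 'I_n}) : step full c = full.
Proof. by rewrite /step finset.setTU. Qed.

Lemma mean_at_unfinished F t :
  mean_at F t - unfinished t = \sum_A law t A * (F A - (A != full)%:R).
Proof.
rewrite /mean_at /unfinished [X in _ - X]big_mkcond -sumrB; apply: eq_bigr => A _.
by case: (A != full); rewrite ?subr0 // mulrBr mulr1.
Qed.

(** By the drift condition, the partial sum plus [mean_at F N] does not increase with [N], and it
    starts at the value of [F] in the initial set. The full set is absorbing and contributes
    nothing. *)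
Lemma sum_unfinished_le F :
  (forall A, start \in A -> 0 <= F A) ->
  (forall A, start \in A -> A != full ->
    wmean (round_law p) (fun c => F (step A c)) <= F A - 1) ->
  forall N, \sum_(t < N) unfinished t <= F [set start]%SET.
Proof.
move=> F0 Fdrift N.
suff : \sum_(t < N) unfinished t + mean_at F N <= F [set start]%SET.
  apply: le_trans; rewrite lerDl; apply: sumr_ge0 => A _.
  have [sA|sA] := boolP (start \in A); last by rewrite informed_law_start ?mul0r.
  by rewrite mulr_ge0 ?informed_law_ge0 ?F0.
elim: N => [|N IH].
  rewrite big_ord0 add0r /mean_at (bigD1 [set start]%SET) //= eqxx mul1r.
  by rewrite big1 ?addr0 // => A /negPf ->; rewrite mul0r.
apply: le_trans IH; rewrite big_ord_recr /= -addrA lerD2l addrC -lerBrDr.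
rewrite mean_at_unfinished mean_atS; apply: ler_sum => A _.
have [sA|sA] := boolP (start \in A); last by rewrite informed_law_start ?mul0r.
apply: ler_wpM2l; first exact: informed_law_ge0.
have [->|AT] := eqVneq A full; last exact: Fdrift.
under eq_wmean do rewrite step_full.
by rewrite wmean_cst ?subr0 // round_law_sum.
Qed.

(** Now the partial sum plus [mean_at F N] does not decrease. Since [F] is at most 0 on the full
    set, the remainder [mean_at F N] is at most [M * unfinished N]. *)
Lemma sum_unfinished_ge F (M : K) :
  F full <= 0 -> (forall A, start \in A -> F A <= M) ->
  (forall A, start \in A -> A != full ->
    F A - 1 <= wmean (round_law p) (fun c => F (step A c))) ->
  forall N, F [set start]%SET - M * unfinished N <= \sum_(t < N) unfinished t.
Proof.
move=> FT FM Fdrift N.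
suff : F [set start]%SET <= \sum_(t < N) unfinished t + mean_at F N.
  rewrite lerBlDr => /le_trans; apply; rewrite lerD2l /mean_at /unfinished.
  rewrite mulr_sumr [leRHS]big_mkcond; apply: ler_sum => A _.
  have [sA|sA] := boolP (start \in A); last first.
    by rewrite informed_law_start // mul0r mulr0; case: ifP.
  case: ifP => [AT|/negbFE/eqP ->]; first by rewrite mulrC ler_wpM2r ?informed_law_ge0 ?FM.
  by rewrite mulr_ge0_le0 ?informed_law_ge0.
elim: N => [|N IH].
  rewrite big_ord0 add0r /mean_at (bigD1 [set start]%SET) //= eqxx mul1r.
  by rewrite big1 ?addr0 // => A /negPf ->; rewrite mul0r.
apply: (le_trans IH); rewrite big_ord_recr /= -addrA lerD2l addrC -lerBlDr.
rewrite mean_at_unfinished mean_atS; apply: ler_sum => A _.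
have [sA|sA] := boolP (start \in A); last by rewrite informed_law_start ?mul0r.
apply: ler_wpM2l; first exact: informed_law_ge0.
have [->|AT] := eqVneq A full; last exact: Fdrift.
under eq_wmean do rewrite step_full.
by rewrite wmean_cst ?subr0 // round_law_sum.
Qed.

Lemma unfinished_ge0 t : 0 <= unfinished t.
Proof. by apply: sumr_ge0 => A _; exact: informed_law_ge0. Qed.

Lemma unfinished_small (B e : K) : 0 < e ->
  (forall N, \sum_(t < N) unfinished t <= B) -> exists N, unfinished N <= e.
Proof.
move=> e0 sumB; apply: contrapT => noN.
have large N : e <= unfinished N.
  by rewrite leNgt; apply/negP => /ltW h; apply: noN; exists N.
have [N BN] : exists N : nat, B / e < N%:R.
  by exists (Num.bound `|B / e|); apply: le_lt_trans (ler_norm _) (archi_boundP _).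
have : \sum_(t < N) e <= B by apply: le_trans (sumB N); exact: ler_sum.
by rewrite sumr_const card_ord leNgt -mulr_natl -ltr_pdivrMr // BN.
Qed.

End ChainTime.

(** * The spreading time as a series of indicators *)

Section SpreadingTime.
Variables (K : realType) (n : nat) (T : Type) (start : 'I_n)
  (call : nat -> 'I_n -> T -> {set 'I_n}).
Local Open Scope ereal_scope.

Local Notation full := [set: 'I_n]%SET.

Lemma informed_full_mono t s w :
  (t <= s)%N -> informed start call t w = full -> informed start call s w = full.
Proof.
move=> /subnK <- tT; elim: (s - t)%N => [|j IH] //=.
by rewrite IH finset.setTU.
Qed.

(** The full set is absorbing, so the first time it is reached equals the number of earlier rounds;
    if it is never reached, both sides are infinite. *)
Lemma spreading_timeE w : spreading_time K start call w =
  \sum_(0 <= t <oo) ((informed start call t w != full)%:R%:E : \bar K).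
Proof.
pose u t : \bar K := (informed start call t w != full)%:R%:E.
rewrite -[RHS]/(\sum_(0 <= t <oo) u t).
have u0 t : (0 <= t)%N -> 0 <= u t by move=> _; rewrite /u lee_fin.
rewrite /spreading_time.
have [[t0 t0T]|never] := pselect (exists t, informed start call t w = full).
  have ex : exists t, informed start call t w == full by exists t0; exact/eqP.
  case: (ex_minnP ex) => tau /eqP tauT tau_min.
  rewrite (nneseries_split 0 tau u0) add0n eseries0 ?adde0; last first.
    by move=> t taut _; rewrite /u (informed_full_mono taut tauT) eqxx.
  rewrite (eq_big_nat _ _ (F2 := fun=> 1)); last first.
    move=> t /andP[_ ttau]; rewrite /u; case: eqP => // /eqP /tau_min.
    by rewrite leqNgt ttau.
  have -> : \sum_(0 <= t < tau) (1 : \bar K) = tau%:R%:E.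
    by rewrite big_mkord sumEFin sumr_const card_ord.
  apply/eqP; rewrite eq_le; apply/andP; split.
    by apply: ereal_inf_lbound; exists tau.
  apply: le_ereal_inf_tmp => _ [t tT <-]; rewrite lee_fin ler_nat.
  by apply: tau_min; apply/eqP.
have -> : [set t%:R%:E | t in [set t | informed start call t w = full]] = set0 :> set (\bar K).
  by apply/seteqP; split => // x [t tT e]; apply: never; exists t.
rewrite ereal_inf0; apply/esym/eq_infty => r.
have u1 t : u t = 1 by rewrite /u; case: eqP => // tT; case: never; exists t.
pose N := Num.bound `|r|.
apply: le_trans (nneseries_lim_ge N (fun t tm _ => u0 t tm)).
rewrite (eq_bigr (fun=> 1)) // big_mkord sumEFin sumr_const card_ord lee_fin.
by apply: le_trans (ler_norm _) (ltW (archi_boundP _)).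
Qed.

End SpreadingTime.

Lemma spreading_time_integral (K : realType) (dR : measure_display)
    (TR : measurableType dR) (PR : probability TR K) (R : {RV PR >-> K}) (n : nat)
    (d : measure_display) (T : measurableType d) (P : probability T K)
    (draw : nat -> 'I_n -> T -> nat) (call : nat -> 'I_n -> T -> {set 'I_n})
    (start : 'I_n) : push_calls PR R P draw call ->
  (\int[P]_w spreading_time K start call w = \sum_(0 <= t <oo)
    (unfinished (fun r : nat => fine (PR [set x | R x = r%:R])) start t)%:E)%E.
Proof.
move=> callsP.
have nfP := not_informed_eventP start (fibre_measurable R) callsP.
under eq_integral do rewrite spreading_timeE.
have indicE' t w : (informed start call t w != [set: 'I_n]%SET)%:R =
    \1_[set w | informed start call t w != [set: 'I_n]%SET] w :> K.
  rewrite indicE; case: (boolP (informed _ _ _ _ != _)) => h; first by rewrite mem_set.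
  by rewrite memNset //= ; exact/negP.
rewrite integral_nneseries //.
- apply: eq_eseriesr => t _; rewrite -(nfP t).2.
  under eq_integral do rewrite indicE'.
  by rewrite integral_indic ?setIT //; exact: (nfP t).1.
- move=> t; under eq_fun do rewrite indicE'.
  by apply/measurable_EFinP; apply: measurable_indic; exact: (nfP t).1.
Qed.

(** * Bounds on the expected time *)

(** The sum of the three correction coefficients of [super_pot_drift], for variance constant
    [b + 2 * c] and [s0 = expR (- (2 * b))]. *)
Definition upper_const (K : realType) (a b c : K) : K :=
  b / ln (1 + a) / (a / (1 + b))
  + (b + 2 * c) / ln (1 + a)
      / ((a / (1 + b)) ^+ 2 / (1 + b + (b + 2 * c) + b ^+ 2))
  + b / expR (- (2 * b)) / a / (a / (2 * (1 + b))).

(** The two coefficients of [sub_pot_drift], plus 1 for the remainder after finitely many rounds. *)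
Definition lower_const (K : realType) (a b c : K) : K :=
  (2 * (b / ln (1 + a)) + 2 * b) / (a / (1 + b))
  + 4 * (b + 2 * c) / expR (- (2 * b)) ^+ 2 / a / (a / (4 * (1 + b))) + 1.

Section PushTime.
Variables (K : realType) (n : nat) (p : nat -> K) (a b c : K).
Hypotheses (n_gt1 : (1 < n)%N) (p_ge0 : forall r, 0 <= p r) (pn : p n = 0)
  (p_sum : \sum_(r < n.+1) p r = 1).
Let m : K := \sum_(r < n.+1) r%:R * p r.
Hypotheses (a_gt0 : 0 < a) (am : a <= m) (mb : m <= b) (bn : 2 * b <= n%:R).
Hypotheses (c_ge0 : 0 <= c) (M2c : \sum_(r < n.+1) r%:R ^+ 2 * p r <= c).

Let V : K := b + 2 * c.
Let s0 : K := expR (- (2 * b)).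
Let D1 : K := b / ln (1 + a) / (a / (1 + b)).
Let D2 : K := V / ln (1 + a) / ((a / (1 + b)) ^+ 2 / (1 + b + V + b ^+ 2)).
Let D3 : K := b / s0 / a / (a / (2 * (1 + b))).
Let E1 : K := (2 * (b / ln (1 + a)) + 2 * b) / (a / (1 + b)).
Let E2 : K := 4 * V / s0 ^+ 2 / a / (a / (4 * (1 + b))).

Local Notation full := [set: 'I_n]%SET.

Let b_gt0 : 0 < b. Proof. exact: lt_le_trans a_gt0 (le_trans am mb). Qed.
Let V_gt0 : 0 < V. Proof. by rewrite ltr_wpDr // mulr_ge0. Qed.
Let n_gt0 : 0 < n%:R :> K. Proof. by rewrite ltr0n ltnW. Qed.

Lemma card_setC_add (A : {set 'I_n}) : #|A|%:R + #|~: A|%:R = n%:R :> K.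
Proof. by rewrite -natrD cardsC card_ord. Qed.

Lemma push_drift (start : 'I_n) (A : {set 'I_n}) : start \in A -> A != full ->
  wmean (round_law p) (fun c => super_pot D1 D2 D3 m n%:R #|~: step A c|%:R) <=
    super_pot D1 D2 D3 m n%:R #|~: A|%:R - 1 /\
  sub_pot E1 E2 m n%:R #|~: A|%:R - 1 <=
    wmean (round_law p) (fun c => sub_pot E1 E2 m n%:R #|~: step A c|%:R).
Proof.
move=> sA AT.
have k_gt0 : (0 < #|A|)%N by apply/card_gt0P; exists start.
have u_gt0 : (0 < #|~: A|)%N.
  rewrite lt0n; apply: contra AT => /eqP /cards0_eq A0.
  by rewrite -[A]finset.setCK A0 finset.setC0.
have kn : (0 < #|A| < n)%N.
  by rewrite k_gt0 -[X in (_ < X)%N]card_ord -(cardsC A) -addn1 leq_add2l.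
have m_gt0 : 0 < m by apply: lt_le_trans am.
have [h1 h2 h3 h4 h5] := avoidance_bounds m_gt0 mb kn bn.
have nkE : (n - #|A|)%:R = #|~: A|%:R :> K.
  by rewrite -[X in (X - _)%N]card_ord -(cardsC A) addKn.
rewrite nkE in h5.
have k1 : 1 <= #|A|%:R :> K by rewrite ler1n.
have u1 : 1 <= #|~: A|%:R :> K by rewrite ler1n.
have U_ge0 (i : {ffun 'I_n -> {set 'I_n}}) : 0 <= #|~: step A i|%:R :> K by [].
have U_le (i : {ffun 'I_n -> {set 'I_n}}) : #|~: step A i|%:R <= #|~: A|%:R :> K.
  by rewrite ler_nat subset_leq_card // finset.setCS finset.subsetUl.
have s0_gt0 : 0 < s0 by exact: expR_gt0.
have s0_le1 : s0 <= 1 by rewrite -expR0 ler_expR oppr_le0 mulr_ge0 // ltW.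
have Umean := mean_uninformed n_gt1 p_sum A.
have bn' : b <= n%:R by move: (ltW b_gt0) bn; lra.
have Uvar := var_uninformed n_gt1 p_ge0 pn p_sum A m_gt0 mb M2c bn'.
split.
  exact: (super_pot_drift (round_law_ge0 p_ge0) (round_law_sum p_sum) a_gt0 V_gt0
    s0_gt0 s0_le1 am mb k1 u1 (card_setC_add A) U_ge0 U_le Umean Uvar h1 h2 h3 h4
    erefl erefl erefl).
exact: (sub_pot_drift (round_law_ge0 p_ge0) (round_law_sum p_sum) a_gt0 V_gt0
    s0_gt0 s0_le1 am mb k1 u1 (card_setC_add A) U_ge0 U_le Umean Uvar h1 h2 h3 h5
    erefl erefl).
Qed.

Let L : K := ln n%:R / ln (1 + m) + m^-1 * ln n%:R.

Let la_gt0 : 0 < ln (1 + a). Proof. by apply: ln_gt0; rewrite ltrDl. Qed.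
Let m_gt0 : 0 < m. Proof. exact: lt_le_trans am. Qed.
Let lm_gt0 : 0 < ln (1 + m). Proof. by apply: ln_gt0; rewrite ltrDl. Qed.
Let b1 : 0 < 1 + b. Proof. by rewrite addr_gt0. Qed.
Let s0_gt0 : 0 < s0. Proof. exact: expR_gt0. Qed.
Let D1_ge0 : 0 <= D1. Proof. by rewrite !divr_ge0 // ltW. Qed.
Let D2_ge0 : 0 <= D2.
Proof.
apply/ltW/divr_gt0; first exact: divr_gt0.
apply: divr_gt0; first exact/exprn_gt0/divr_gt0.
by apply: addr_gt0; [apply: addr_gt0 | exact: exprn_gt0].
Qed.
Let D3_ge0 : 0 <= D3.
Proof. by apply/ltW; rewrite !divr_gt0 // mulr_gt0. Qed.
Let E1_ge0 : 0 <= E1.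
Proof.
apply/ltW; rewrite divr_gt0 ?divr_gt0 // addr_gt0 // mulr_gt0 //.
by rewrite divr_gt0.
Qed.
Let E2_ge0 : 0 <= E2.
Proof. by apply/ltW; rewrite !divr_gt0 ?mulr_gt0 ?exprn_gt0. Qed.
Let ln_n_ge0 : 0 <= ln n%:R :> K. Proof. by rewrite ln_ge0 // ler1n ltnW. Qed.

Lemma card_ineqs (start : 'I_n) (A : {set 'I_n}) : start \in A ->
  1 <= n%:R - #|~: A|%:R :> K /\ n%:R - #|~: A|%:R <= n%:R :> K.
Proof.
move=> sA; rewrite -(card_setC_add A) addrK lerDl; split=> //.
by rewrite ler1n; apply/card_gt0P; exists start.
Qed.

Lemma card_setC1_start (start : 'I_n) : #|~: [set start]%SET|%:R = n%:R - 1 :> K.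
Proof. by rewrite -(card_setC_add [set start]%SET) cards1 addrAC subrr add0r. Qed.

(** At the start [u = n - 1] and [n - u = 1], so the potential is [L] plus corrections bounded by
    their coefficients. *)
Lemma sum_unfinished_push_le (start : 'I_n) (N : nat) :
  \sum_(t < N) unfinished p start t <= L + upper_const a b c.
Proof.
rewrite -[upper_const a b c]/(D1 + D2 + D3).
apply: (le_trans (sum_unfinished_le p_ge0 p_sum
  (F := fun A => super_pot D1 D2 D3 m n%:R #|~: A|%:R) _ _ N)).
- move=> A sA; have [k1 kn] := card_ineqs sA.
  have u0 : 0 <= #|~: A|%:R :> K by [].
  rewrite /super_pot; move: (#|~: A|%:R) u0 k1 kn => u u0 k1 kn.
  have h1 : 0 <= (ln n%:R - ln (n%:R - u)) / ln (1 + m).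
    apply: divr_ge0; last exact: ltW.
    by rewrite subr_ge0 ler_ln ?posrE //; lra.
  have h2 : 0 <= ln (1 + u) / m by apply: divr_ge0; [apply: ln_ge0; lra | exact: ltW].
  have h3 : 0 <= D1 * (u / n%:R) by apply: mulr_ge0 => //; apply: divr_ge0 => //; exact: ltW.
  have h4 : 0 <= D2 / (n%:R - u) by apply: divr_ge0 => //; lra.
  have h5 : 0 <= D3 * (1 - (1 + u)^-1).
    by rewrite mulr_ge0 // subr_ge0 invf_le1; lra.
  by rewrite !addr_ge0.
- by move=> A sA AT; exact: (push_drift sA AT).1.
rewrite card_setC1_start /super_pot.
have -> : n%:R - (n%:R - 1) = 1 :> K by ring.
have -> : 1 + (n%:R - 1) = n%:R :> K by ring.
rewrite ln1 subr0 divr1 /L [m^-1 * _]mulrC.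
have : D1 * ((n%:R - 1) / n%:R) <= D1.
  by apply: ler_piMr => //; rewrite ler_pdivrMr //; lra.
have : D3 * (1 - n%:R^-1) <= D3.
  by apply: ler_piMr => //; rewrite gerBl invr_ge0.
lra.
Qed.

Lemma sum_unfinished_push_ge (start : 'I_n) :
  exists N, L - lower_const a b c <= \sum_(t < N) unfinished p start t.
Proof.
rewrite -[lower_const a b c]/(E1 + E2 + 1).
have L0 : 0 <= L by rewrite addr_ge0 ?divr_ge0 ?mulr_ge0 ?invr_ge0 // ltW.
have L1 : 0 < L + 1 by rewrite ltr_wpDl.
(* The potential is at most [L], so [L + 1] is a positive bound for it; tail probability at most its
   inverse keeps the remainder below 1. *)
have e0 : 0 < (L + 1)^-1 by rewrite invr_gt0.
have [N smallN] := unfinished_small e0 (sum_unfinished_push_le start).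
exists N.
apply: (@le_trans _ _ (sub_pot E1 E2 m n%:R #|~: [set start]%SET|%:R
    - (L + 1) * unfinished p start N)).
  rewrite card_setC1_start /sub_pot.
  have -> : n%:R - (n%:R - 1) = 1 :> K by ring.
  have -> : 1 + (n%:R - 1) = n%:R :> K by ring.
  rewrite ln1 subr0 /L [m^-1 * _]mulrC -/L.
  have : E1 * ((n%:R - 1) / n%:R) <= E1.
    by apply: ler_piMr => //; rewrite ler_pdivrMr //; lra.
  have : E2 * (1 - (Num.sqrt n%:R)^-1) <= E2.
    by apply: ler_piMr => //; rewrite gerBl invr_ge0 sqrtr_ge0.
  have : (L + 1) * unfinished p start N <= 1.
    by rewrite -[leRHS](@divff _ (L + 1)) ?gt_eqF // ler_pM2l.
  rewrite /L [m^-1 * _]mulrC; lra.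
apply: (sum_unfinished_ge p_ge0 p_sum
  (F := fun A => sub_pot E1 E2 m n%:R #|~: A|%:R)).
- rewrite finset.setCT cards0 /sub_pot subr0 subrr addr0 ln1 sqrtr1 invr1 subrr.
  by rewrite !(mul0r, mulr0, subr0, addr0).
- move=> A sA; have [k1 kn] := card_ineqs sA.
  have u0 : 0 <= #|~: A|%:R :> K by [].
  rewrite /sub_pot; move: (#|~: A|%:R) u0 k1 kn => u u0 k1 kn.
  have h1 : (ln n%:R - ln (n%:R - u)) / ln (1 + m) <= ln n%:R / ln (1 + m).
    by rewrite ler_pM2r ?invr_gt0 // gerBl ln_ge0.
  have h2 : ln (1 + u) / m <= ln n%:R / m.
    by rewrite ler_pM2r ?invr_gt0 // ler_ln ?posrE //; lra.
  have h3 : 0 <= E1 * (u / n%:R) by apply: mulr_ge0 => //; apply: divr_ge0 => //; exact: ltW.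
  have h4 : 0 <= E2 * (1 - (Num.sqrt (1 + u))^-1).
    rewrite mulr_ge0 // subr_ge0 invf_le1 ?sqrtr_gt0; last lra.
    by rewrite -[leLHS]sqrtr1 ler_sqrt; lra.
  rewrite /L [m^-1 * _]mulrC; lra.
by move=> A sA AT; exact: (push_drift sA AT).2.
Qed.

End PushTime.

Lemma abse_sub_le (K : realType) (x : \bar K) (l C : K) :
  ((l - C)%:E <= x)%E -> (x <= (l + C)%:E)%E -> (`|x - l%:E| <= C%:E)%E.
Proof.
by case: x => [r| |] //=; rewrite !lee_fin => lr ru; rewrite ler_distl lr ru.
Qed.

Theorem theorem57 (K : realType)
  (dR : nat -> measure_display)
  (TR : forall n : nat, measurableType (dR n))
  (PR : forall n : nat, probability (TR n) K)
  (R : forall n : nat, {RV (PR n) >-> K})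
  (R_range : forall (n : nat) (x : TR n), (0 < n)%N ->
     exists2 k : nat, (k < n)%N & R n x = k%:R)
  (R_mean : exists a b : K, 0 < a /\
     \forall n \near \oo, (a%:E <= 'E_(PR n)[R n] <= b%:E)%E)
  (R_variance : exists c : K,
     \forall n \near \oo, ('V_(PR n)[R n] <= c%:E)%E) :
  exists C : K, \forall n \near \oo,
    forall (d : measure_display) (T : measurableType d) (P : probability T K)
      (draw : nat -> 'I_n -> T -> nat) (call : nat -> 'I_n -> T -> {set 'I_n})
      (start : 'I_n),
    push_calls (PR n) (R n) P draw call ->
    let m : K := fine 'E_(PR n)[R n] in
    (`| (\int[P]_w spreading_time K start call w)
        - (log_base (1 + m) n%:R + m^-1 * ln n%:R)%:E | <= C%:E)%E.
Proof.
have [a [b [a_gt0 abm]]] := R_mean; have [c0 Vc] := R_variance.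
(* This bounds the second moment, the variance plus the squared mean; the absolute value makes it
   nonnegative. *)
pose c := `|c0| + b ^+ 2.
have c_ge0 : 0 <= c by rewrite addr_ge0 ?sqr_ge0.
exists (Num.max (upper_const a b c) (lower_const a b c)).
near=> n => d T P draw call start callsP; cbv zeta; set m := fine _.
have n_gt1 : (1 < n)%N by near: n; exact: nbhs_infty_gt.
have bn : 2 * b <= n%:R by near: n; exact: nbhs_infty_ger.
have /andP[aE Eb] : (a%:E <= 'E_(PR n)[R n] <= b%:E)%E by near: n.
have Vn : ('V_(PR n)[R n] <= c0%:E)%E by near: n.
have range x : exists2 k : nat, (k < n)%N & R n x = k%:R by apply: R_range; exact: ltnW.
pose p r := fine (PR n [set x | R n x = r%:R]).
have mE : m = \sum_(r < n.+1) r%:R * p r by rewrite /m (natural_mean range).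
have am : a <= \sum_(r < n.+1) r%:R * p r by rewrite -lee_fin -(natural_mean range).
have mb : \sum_(r < n.+1) r%:R * p r <= b by rewrite -lee_fin -(natural_mean range).
have M2c : \sum_(r < n.+1) r%:R ^+ 2 * p r <= c.
  apply: le_trans (natural_second_moment range Vn Eb) _.
  by rewrite lerD2r ler_norm.
have p_ge0 r : 0 <= p r by exact: natural_law_ge0.
have pn : p n = 0 := natural_law_outside range.
have p_sum : \sum_(r < n.+1) p r = 1 := natural_law_sum range.
rewrite (spreading_time_integral start callsP) /log_base mE.
have upper N := sum_unfinished_push_le n_gt1 p_ge0 pn p_sum a_gt0 am mb bn c_ge0 M2c start N.
have [N lower] := sum_unfinished_push_ge n_gt1 p_ge0 pn p_sum a_gt0 am mb bn c_ge0 M2c start.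
have u_ge0 t : (0 <= (unfinished p start t)%:E :> \bar K)%E.
  by rewrite lee_fin unfinished_ge0.
(* For the lower bound the single partial sum up to [N] suffices; for the upper bound all partial
   sums are bounded, hence their limit. *)
apply: abse_sub_le.
  apply: le_trans (nneseries_lim_ge N (fun t _ _ => u_ge0 t)).
  rewrite big_mkord sumEFin lee_fin; apply: le_trans lower.
  by rewrite lerD2l lerN2 le_max lexx orbT.
apply: lime_le; first exact: is_cvg_nneseries.
apply: nearW => M; rewrite big_mkord sumEFin lee_fin; apply: le_trans (upper M) _.
by rewrite lerD2l le_max lexx.
Unshelve. all: by end_near.
Qed.
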